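(* If $\Gamma$ is a finite simplicial graph, then the topological complexity of the associated cell complex $X_\Gamma$ is $\mathsf{TC}(X_\Gamma)=z(\Gamma)+1$.
   Context: Topological complexity. Let $X$ be a path-connected space with the homotopy type of a finite CW-complex. $PX$ is the space of continuous paths $\gamma\colon[0,1]\to X$ with the compact-open topology, and $\pi\colon PX\to X\times X$ is $\pi(\gamma)=(\gamma(0),\gamma(1))$. A motion planner for $X$ is a collection of pairwise disjoint subsets $F_1,\dots,F_m$ covering $X\times X$, each a Euclidean Neighborhood Retract, together with continuous maps $s_i\colon F_i\to PX$ with $\pi\circ s_i=\mathrm{id}_{F_i}$. $\mathsf{TC}(X)$ is the minimal number $m$ of sets $F_i$ over all motion planners for $X$. Graphs and complexes. A finite simplicial graph $\Gamma$ has a finite vertex set $\mathcal{V}$, edge set $\mathcal{E}\subseteq\binom{\mathcal{V}}{2}$, and no loops or multiple edges. A clique is a complete subgraph of $\Gamma$. The flag complex $\Delta_\Gamma$ is the simplicial complex whose simplices are the vertex sets of cliques of $\Gamma$. Put $n=|\mathcal{V}|$ and identify $\mathcal{V}$ with $[n]=\{1,\dots,n\}$. The torus $(S^1)^{\times n}$ has the standard CW-decomposition with cells $\{\mathbf{x} : x_i=e\text{ if }i\notin J,\ x_i\neq e\text{ if } i\in J\}$ for $J\subseteq[n]$, where $e=1\in S^1\subset\mathbb{C}$. $X_\Gamma$ is the subcomplex of $(S^1)^{\times n}$ obtained by deleting the cells corresponding to the non-faces of $\Delta_\Gamma$, i.e. the union of the cells indexed by those $J$ that are empty or vertex sets of cliques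 of $\Gamma$. (It is an Eilenberg-Mac Lane space of type $K(G_\Gamma,1)$ for the right-angled Artin group $G_\Gamma=\langle v\in\mathcal{V}\mid vw=wv\text{ if }\{v,w\}\in\mathcal{E}\rangle$.) $z(\Gamma)=\max_{K_1,K_2}|\mathcal{V}_{K_1}\cup\mathcal{V}_{K_2}|$ is the largest cardinality of the union of the vertex sets of two cliques $K_1,K_2$ in $\Gamma$. *)

(* Defs.v *)
From HB Require Import structures.
From mathcomp Require Import all_boot all_order all_algebra.
From mathcomp Require Import all_classical all_reals all_analysis.

Set Implicit Arguments.
Unset Strict Implicit.
Unset Printing Implicit Defensive.

Import Order.TTheory GRing.Theory Num.Theory.
Import numFieldNormedType.Exports.

Local Open Scope classical_set_scope.
Local Open Scope ring_scope.

(* In this file a set [A : set T] used as a type is [set_type A], which carries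
   the subspace (initial) topology. *)

Section PathSpace.
Variable R : realType.

Definition unit_interval : set R := `[0, 1]%classic.

Lemma unit_interval0 : 0 \in unit_interval.
Proof. by apply/mem_set; rewrite /unit_interval /= in_itv /= lexx ler01. Qed.

Lemma unit_interval1 : 1 \in unit_interval.
Proof. by apply/mem_set; rewrite /unit_interval /= in_itv /= ler01 lexx. Qed.

Definition I0 : unit_interval := exist _ 0 unit_interval0.
Definition I1 : unit_interval := exist _ 1 unit_interval1.

Definition path_space (X : topologicalType) : Type :=
  continuousType unit_interval X.

Definition path_fun (X : topologicalType) (g : path_space X) :
  {compact-open, unit_interval -> X} := g : continuousType unit_interval X.

HB.instance Definition _ (X : topologicalType) := gen_eqMixin (path_space X).
HB.instance Definition _ (X : topologicalType) :=
  gen_choiceMixin (path_space X).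
HB.instance Definition _ (X : topologicalType) :=
  Topological.copy (path_space X) (initial_topology (@path_fun X)).

Definition endpoints (X : topologicalType) (g : path_space X) : X * X :=
  (path_fun g I0, path_fun g I1).

End PathSpace.

Definition homeomorphic (S T : topologicalType) : Prop :=
  exists (f : S -> T) (g : T -> S),
    [/\ continuous f, continuous g, cancel f g & cancel g f].

Definition is_retract (T : topologicalType) (Y U : set T) : Prop :=
  Y `<=` U /\
  exists r : U -> Y,
    continuous r /\ forall u : U, Y (val u) -> val (r u) = val u.

Definition is_ENR (R : realType) (E : topologicalType) : Prop :=
  exists (N : nat) (Y U : set 'rV[R]_N),
    [/\ homeomorphic E Y, open U & is_retract Y U].

(* The domains [F i] may be empty; this does not affect the least [m], as empty
   domains can be dropped. *)
Definition has_motion_planner (R : realType) (X : topologicalType) (m : nat) :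
    Prop :=
  exists F : 'I_m -> set (X * X),
    [/\ trivIset setT F,
        \bigcup_i F i = setT,
        (forall i, is_ENR R (F i)) &
        exists s : forall i, F i -> path_space R X,
          forall i, continuous (s i) /\
                    forall p : F i, endpoints (s i p) = val p].

(* [is_TC R X m] reads "TC(X) = m"; a relation, since TC is undefined for a
   space with no finite motion planner. *)
Definition is_TC (R : realType) (X : topologicalType) (m : nat) : Prop :=
  has_motion_planner R X m /\
  forall k, has_motion_planner R X k -> (m <= k)%N.

Section GraphComplex.
Variables (R : realType) (V : finType).

(* A graph is given by its set [E] of edges, each a two-element set of
   vertices. *)
Definition is_simple_graph (E : {set {set V}}) : Prop :=
  forall A : {set V}, A \in E -> #|A| = 2.

Definition is_clique (E : {set {set V}}) (K : {set V}) : bool :=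
  [forall x in K, forall y in K, (x != y) ==> ([set x; y]%SET \in E)].

(* Faces of the flag complex, including the empty face. *)
Definition flag_complex (E : {set {set V}}) : {set {set V}} :=
  [set K : {set V} | is_clique E K]%SET.

(* The complex plane is identified with R * R, so that e = 1 is (1, 0). *)
Definition circle : set (R * R) := [set p | p.1 ^+ 2 + p.2 ^+ 2 = 1].

Lemma circle_e_subproof : ((1, 0) : R * R) \in circle.
Proof. by apply/mem_set; rewrite /circle /= expr1n expr0n addr0. Qed.

Definition circle_e : circle := exist _ (1, 0) circle_e_subproof.

Definition torus : topologicalType :=
  prod_topology (fun _ : V => (circle : Type)).

Definition torus_cell (J : {set V}) : set torus :=
  [set x | forall i : V, (i \notin J -> x i = circle_e) /\
                         (i \in J -> x i <> circle_e)].

Definition X_graph (E : {set {set V}}) : set torus :=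
  \bigcup_(J in [set` flag_complex E]) torus_cell J.

Definition z_graph (E : {set {set V}}) : nat :=
  \max_(K : {set V} * {set V} | is_clique E K.1 && is_clique E K.2)
    #|K.1 :|: K.2|%SET.

End GraphComplex.

Arguments circle_e R : clear implicits.
Arguments X_graph R {V} E.

(* Main.v *)
Require Import Defs.
From mathcomp Require Import all_boot all_order all_algebra.
From mathcomp Require Import all_classical all_reals all_analysis.
From mathcomp Require Import fingroup perm ring lra zify.

(** Write T for the circle, e for its base point, X for the graph complex and
    z for the largest cardinality of a union of two cliques K1, K2.

    Lower bound. After replacing K2 by K2 minus K1, the torus T^z maps to
    X * X: the coordinates in K1 go to the first factor, those in K2 to the
    second, everything else is e. Over a piece of a motion planner, the
    planned path carries each coordinate of T^z to e (or e to it), continuously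
    in the point. Lifting the paths to R shows that, over the preimage of the
    piece in R^z, the coordinate x_i agrees up to a locally constant integer
    label with a function that is periodic, that is, with a real logarithm of
    the i-th circle coordinate ([contraction_label], [planner_label]). With at
    most z pieces one could use the i-th coordinate over the i-th piece, and
    [torus_cover] says that this is impossible.

    This last fact is the cup length argument: the product of the classes
    dx_1, ..., dx_z of T^z is not zero, although dx_i becomes exact over the
    i-th set. It is carried out with cochains on a finite grid. By compactness
    a cover yields a coloring of the cubes of a fine periodic grid such that
    the label is constant on clusters of cubes of one color. Correcting x_i
    by the label on the cubes of color i gives a function F_i that is constant
    on each of these cubes, so that dF_1 u ... u dF_z vanishes on every simplex
    of the Kuhn triangulation ([torus_coloring]). But the sum of this product
    over the torus does not change when a factor is modified by a periodic
    function ([deg_exchange]), because the difference is a coboundary, and for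
    the coordinates themselves it is the number of cubes ([deg_coordE]).

    Upper bound. Sort the pairs (x, y) by the number of vertices v at which
    x_v and y_v are antipodal. Such a v lies in the support of x or of y, and
    the supports are cliques, so there are z + 1 strata. On a stratum the set
    of antipodal vertices is locally constant, so each coordinate can move along
    the shorter arc when x_v and y_v are not antipodal, and along a fixed half
    circle otherwise. The speed is chosen such that a coordinate with x_v = e
    rests during the first half of the time, and one with y_v = e during the
    second half ([slide_early], [slide_late]); hence the support of the moving
    point stays inside the support of x, then inside that of y, and the path
    stays in X. A stratum is a neighborhood retract ([piece_ENR]): a point near
    X is pushed into X by shrinking all its coordinates towards e by an amount
    that measures how far its support is from a clique, and this can be done
    for x and y in turn without separating antipodal coordinates. *)

Set Implicit Arguments.
Unset Strict Implicit.
Unset Printing Implicit Defensive.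

Import Order.TTheory GRing.Theory Num.Theory.
Import numFieldNormedType.Exports.

Local Open Scope classical_set_scope.
Local Open Scope ring_scope.

(** * Simplicial cup products of coboundaries *)

Section Cochains.
Variable P : Type.
Implicit Types (w : nat -> P) (Gs : seq (P -> int)) (eta : (nat -> P) -> int).

(** A function on sequences [w] of points plays the role of an ordered cochain,
    of degree [p] if it reads [w 0, ..., w p] only. This is the cup product of
    the coboundaries of the functions in [Gs], then of [eta]. *)
Fixpoint cup Gs eta w : int :=
  if Gs is G :: Gs' then (G (w 1%N) - G (w 0%N)) * cup Gs' eta (w \o S)
  else eta w.

(** [bump j] skips the index [j], so [w \o bump j] is the [j]-th face. *)
Definition cobound p eta w : int :=
  \sum_(j < p.+2) (-1) ^+ j * eta (w \o bump j).

Lemma cup_cat Gs1 Gs2 eta : cup (Gs1 ++ Gs2) eta = cup Gs1 (cup Gs2 eta).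
Proof.
elim: Gs1 => [//|G Gs1 IH]; apply/funext => w /=.
by rewrite IH.
Qed.

Lemma comp_bumpS w j : (w \o bump j.+1) \o S = (w \o S) \o bump j.
Proof. by apply/funext => k /=; rewrite bumpS. Qed.

Lemma comp_bump0 w : w \o bump 0 = w \o S.
Proof. by apply/funext => k /=; rewrite /bump leq0n add1n. Qed.

Lemma coboundE p eta w : cobound p eta w =
  eta (w \o S) - \sum_(j < p.+1) (-1) ^+ j * eta (w \o bump j.+1).
Proof.
rewrite /cobound big_ord_recl /= expr0 mul1r comp_bump0 -sumrN; congr (_ + _).
by apply: eq_bigr => j _; rewrite exprS mulN1r mulNr.
Qed.

(** Leibniz rule for a factor that is itself a coboundary: the faces 0 and 1
    recombine because [G] telescopes along the first two edges. *)
Lemma cobound_cup1 G p eta w :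
  cobound p.+1 (fun w => (G (w 1%N) - G (w 0%N)) * eta (w \o S)) w =
  - ((G (w 1%N) - G (w 0%N)) * cobound p eta (w \o S)).
Proof.
rewrite coboundE big_ord_recl /= expr0 mul1r comp_bumpS comp_bump0.
rewrite (eq_bigr (fun j : 'I_p.+1 => - ((G (w 1%N) - G (w 0%N)) *
  ((-1) ^+ j * eta ((w \o S) \o bump j.+1))))); last first.
  move=> j _; rewrite [bump 0 j]add1n comp_bumpS.
  by rewrite exprS mulN1r mulNr mulrCA.
rewrite sumrN -big_distrr /= coboundE /bump /=; ring.
Qed.

Lemma cobound_cup Gs p eta w :
  cobound (size Gs + p) (cup Gs eta) w =
  (-1) ^+ size Gs * cup Gs (cobound p eta) w.
Proof.
elim: Gs w => [|G Gs IH] w /=; first by rewrite add0n mul1r.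
by rewrite addSn cobound_cup1 IH exprS; ring.
Qed.

(** Leibniz rule for a factor of degree 0. *)
Lemma cobound_mul0 phi p eta w :
  cobound p (fun w => phi (w 0%N) * eta w) w =
  (phi (w 1%N) - phi (w 0%N)) * eta (w \o S) + phi (w 0%N) * cobound p eta w.
Proof.
rewrite !coboundE /= mulrBr mulrBl -/(_ _) big_distrr /=.
rewrite (eq_bigr (fun j : 'I_p.+1 =>
  phi (w 0%N) * ((-1) ^+ j * eta (w \o bump j.+1)))); last first.
  by move=> j _; rewrite mulrCA.
ring.
Qed.

Lemma cobound_const w : cobound 0 (fun=> 1) w = 0.
Proof. by rewrite /cobound !big_ord_recl big_ord0. Qed.

(** Since all other factors are closed, the factor [d phi] can be pulled out:
    a product of coboundaries is the coboundary of the same product with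
    [phi] in place of [d phi]. *)
Lemma cup_cobound Gs1 phi Gs2 w :
  cup (Gs1 ++ phi :: Gs2) (fun=> 1) w =
  (-1) ^+ size Gs1 * cobound (size Gs1 + size Gs2)
    (cup Gs1 (fun w => phi (w 0%N) * cup Gs2 (fun=> 1) w)) w.
Proof.
rewrite cobound_cup mulrA -signr_odd -expr2 sqrr_sign mul1r cup_cat.
congr (cup _ _ _); apply/funext => {}w /=; rewrite cobound_mul0.
have := cobound_cup Gs2 0 (fun=> 1) w; rewrite addn0 => ->.
suff -> : cup Gs2 (cobound 0 (fun=> 1)) w = 0 by rewrite !mulr0 addr0.
elim: Gs2 w => [|G Gs2 IH] w /=; first exact: cobound_const.
by rewrite IH mulr0.
Qed.

Lemma cupB Gs1 F X Gs2 w :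
  cup (Gs1 ++ (fun v => F v - X v) :: Gs2) (fun=> 1) w =
  cup (Gs1 ++ F :: Gs2) (fun=> 1) w - cup (Gs1 ++ X :: Gs2) (fun=> 1) w.
Proof.
elim: Gs1 w => [|G Gs1 IH] w /=; last by rewrite IH; ring.
by ring.
Qed.

Lemma cup_prod Gs G0 w : cup Gs (fun=> 1) w =
  \prod_(k < size Gs) (nth G0 Gs k (w k.+1) - nth G0 Gs k (w k)).
Proof.
elim: Gs w => [|G Gs IH] w /=; first by rewrite big_ord0.
by rewrite big_ord_recl IH.
Qed.

End Cochains.

(** * Sums over the Kuhn triangulation of a torus *)

Section Torus.
Variables (n N : nat).
Hypothesis N_gt0 : (0 < N)%N.
Local Notation pt := {ffun 'I_n -> int}.
Implicit Types (u v z : pt) (s : 'S_n) (w : nat -> pt).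

Definition unit_pt (i : 'I_n) : pt := [ffun j => (j == i)%:R].

(** The vertices [kuhn u s 0, ..., kuhn u s n] are those of the simplex of the
    Kuhn triangulation that lies in the unit cube at [u] and whose edges follow
    the axes in the order [s]. *)
Definition kuhn u s (k : nat) : pt :=
  u + \sum_(i < n | (i < k)%N) unit_pt (s i).
Definition grid_pt (a : {ffun 'I_n -> 'I_N}) : pt := [ffun i => (a i : nat)%:Z].

Definition periodic (T : Type) (f : pt -> T) :=
  forall v z, f (v + z *+ N) = f v.

Definition periodic_cochain (eta : (nat -> pt) -> int) :=
  forall w z, eta (fun k => w k + z *+ N) = eta w.

Lemma kuhn0 u s : kuhn u s 0 = u.
Proof. by rewrite /kuhn big_pred0 ?addr0. Qed.

Lemma kuhnS u s (k : 'I_n) : kuhn u s k.+1 = kuhn u s k + unit_pt (s k).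
Proof.
rewrite /kuhn -addrA; congr (_ + _).
rewrite (bigD1 k) //= addrC; congr (_ + _).
by apply: eq_bigl => i; rewrite ltnS ltn_neqAle andbC.
Qed.

Lemma sum_grid_shift (i : 'I_n) (f : pt -> int) : periodic f ->
  \sum_a f (grid_pt a + unit_pt i) = \sum_a f (grid_pt a).
Proof.
move=> fper.
pose h (a : {ffun 'I_n -> 'I_N}) : {ffun 'I_n -> 'I_N} :=
  [ffun j => if j == i then ordS (a j) else a j].
have h_inj : injective h.
  move=> a b /ffunP hab; apply/ffunP => j; have := hab j; rewrite !ffunE.
  by case: eqP => // _ /(can_inj (@ordSK _)).
rewrite [RHS](reindex_inj h_inj) /=; apply: eq_bigr => a _.
(* The shift wraps around where the coordinate reaches the side of the torus. *)
pose z : pt := [ffun j => if (j == i) && ((a i).+1 == N) then 1 else 0].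
rewrite -(fper (grid_pt (h a)) z); congr f; apply/ffunP => j.
rewrite !ffunE ffunMnE !ffunE; case: (eqVneq j i) => [->|_] /=; last first.
  by rewrite mul0rn !addr0.
case: eqVneq => [aN|aN].
  by rewrite aN modnn; lia.
have aN' : ((a i).+1 < N)%N by rewrite ltn_neqAle aN ltn_ord.
by rewrite modn_small // mul0rn; lia.
Qed.

(** Evaluation of a cochain on the fundamental cycle of the torus of side
    [N]. *)
Definition kuhn_sum (eta : (nat -> pt) -> int) : int :=
  \sum_a \sum_(s : 'S_n) (-1) ^+ s * eta (kuhn (grid_pt a) s).

(** Exchanging two consecutive directions moves only the vertex between them. *)
Lemma kuhn_tperm u s (i j : 'I_n) (k : nat) :
  j = i.+1 :> nat -> k != j :> nat -> kuhn u (tperm i j * s)%g k = kuhn u s k.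
Proof.
move=> ji kj; congr (_ + _).
rewrite [RHS](reindex_inj (@perm_inj _ (tperm i j))) /=.
apply: eq_big => [l|l _]; last by rewrite permM.
by case: tpermP => [->|->|//]; lia.
Qed.

(** An inner face is shared by two simplices of the same cube, which have
    opposite orientations. *)
Lemma kuhn_sum_inner eta (j : nat) : (0 < j < n)%N ->
  kuhn_sum (fun w => eta (w \o bump j)) = 0.
Proof.
case/andP=> j_gt0 jn; rewrite /kuhn_sum big1 // => a _.
have j1n : (j.-1 < n)%N by lia.
pose t := tperm (Ordinal j1n) (Ordinal jn).
set S := (X in X = 0).
suff : S = - S by lia.
rewrite {1}/S (reindex_inj (mulgI t)) /= -sumrN; apply: eq_bigr => s _.
have -> : odd_perm (t * s)%g = ~~ odd_perm s.
  by rewrite odd_permM odd_tperm -val_eqE /=; case: odd_perm; lia.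
rewrite signrN -mulNr; congr (_ * eta _); apply/funext => k /=.
apply: kuhn_tperm; first by rewrite /=; lia.
by rewrite eq_sym neq_bump.
Qed.

End Torus.

Section Rotation.
Variables (m N : nat).
Hypothesis N_gt0 : (0 < N)%N.
Local Notation n := m.+1.
Local Notation pt := {ffun 'I_n -> int}.
Implicit Types (u v z : pt) (s : 'S_n) (w : nat -> pt).

(** The cyclic permutation [i |-> i + 1]; the lift form gives its parity. *)
Definition rot_perm : 'S_n := lift_perm ord_max ord0 1%g.

Lemma rot_perm_lt (i j : 'I_n) : j = i.+1 :> nat -> rot_perm i = j.
Proof.
move=> ji; have im : (i < m)%N by have := ltn_ord j; lia.
have -> : i = lift ord_max (Ordinal im).
  by apply: val_inj; rewrite /= /bump leqNgt im.
by rewrite lift_perm_lift perm1; apply: val_inj; rewrite /= /bump; lia.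
Qed.

Lemma odd_rot_perm : odd_perm rot_perm = odd m.
Proof. by rewrite odd_lift_perm odd_perm1 /= !addbF. Qed.

(** The face without the first vertex of a simplex is the face without the
    last vertex of a simplex in an adjacent cube. *)
Lemma kuhn_rot u s k : (k < n)%N ->
  kuhn u s k.+1 = kuhn (u + unit_pt (s ord0)) (rot_perm * s)%g k.
Proof.
move=> kn; elim: k kn => [|k IH] kn.
  by rewrite (@kuhnS _ _ _ ord0) !kuhn0.
have k'n : (k < n)%N by lia.
rewrite (@kuhnS _ _ _ (Ordinal kn)) IH // (@kuhnS _ _ _ (Ordinal k'n)).
by rewrite permM (@rot_perm_lt _ (Ordinal kn)).
Qed.

Lemma kuhnDz u z s k : kuhn (u + z) s k = kuhn u s k + z.
Proof. by rewrite /kuhn addrAC. Qed.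

Local Notation kuhn_sum := (@kuhn_sum n N).
Local Notation periodic_cochain := (@periodic_cochain n N).

(** The condition that [eta] is a cochain of degree [n - 1]. *)
Definition local_cochain (eta : (nat -> pt) -> int) :=
  forall w w', (forall k, (k < n)%N -> w k = w' k) -> eta w = eta w'.

Lemma kuhn_sum_outer eta : local_cochain eta -> periodic_cochain eta ->
  kuhn_sum (fun w => eta (w \o S)) = (-1) ^+ m * kuhn_sum eta.
Proof.
move=> eta_loc eta_per; rewrite /kuhn_sum exchange_big /=.
rewrite [in RHS]exchange_big /= [in RHS](reindex_inj (mulgI rot_perm)) /=.
rewrite big_distrr /=; apply: eq_bigr => s _.
rewrite -!big_distrr /= odd_permM odd_rot_perm signr_addb signr_odd mulrA mulrA.
rewrite -expr2 sqrr_sign mul1r; congr (_ * _).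
rewrite -(@sum_grid_shift _ _ N_gt0 (s ord0)
  (fun v => eta (kuhn v (rot_perm * s)%g))).
  apply: eq_bigr => a _; apply: eta_loc => k kn; exact: kuhn_rot.
move=> v z; rewrite -[RHS](eta_per _ z); congr eta.
by apply/funext => k; rewrite kuhnDz.
Qed.

(** Stokes formula on the torus, which has no boundary. *)
Lemma kuhn_sum_cobound eta : local_cochain eta -> periodic_cochain eta ->
  kuhn_sum (cobound m eta) = 0.
Proof.
move=> eta_loc eta_per.
transitivity
    (\sum_(j < n.+1) (-1) ^+ j * kuhn_sum (fun w => eta (w \o bump j))).
  rewrite /kuhn_sum /cobound.
  under eq_bigr do under eq_bigr do rewrite big_distrr /=.
  under eq_bigr do rewrite exchange_big /=.
  rewrite exchange_big /=; apply: eq_bigr => j _.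
  rewrite big_distrr /=; apply: eq_bigr => a _.
  by rewrite big_distrr /=; apply: eq_bigr => s _; rewrite mulrCA.
rewrite big_ord_recl big_ord_recr /= expr0 mul1r.
rewrite (_ : (fun w => eta (w \o bump 0)) = fun w => eta (w \o S)); last first.
  by apply/funext => w; rewrite comp_bump0.
rewrite kuhn_sum_outer // big1 ?add0r; last first.
  move=> j _; rewrite kuhn_sum_inner ?mulr0 //.
  by rewrite /bump /= add1n ltnS ltn_ord.
rewrite (_ : (fun w => eta (w \o bump (bump 0 m))) = eta); last first.
  apply/funext => w; apply: eta_loc => k kn /=; rewrite /bump.
  by congr w; lia.
by rewrite /bump add1n exprS; ring.
Qed.

End Rotation.

(** * Invariance of the degree *)

Section CupPeriodic.
Variables (n N : nat).
Local Notation pt := {ffun 'I_n -> int}.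
Implicit Types (u v z : pt) (s : 'S_n) (w : nat -> pt) (G : pt -> int).

Definition quasi_periodic G :=
  forall z, exists a, forall v, G (v + z *+ N) = G v + a.

Lemma cup_local Gs w w' : (forall k, (k <= size Gs)%N -> w k = w' k) ->
  cup Gs (fun=> 1) w = cup Gs (fun=> 1) w'.
Proof.
elim: Gs w w' => [//|G Gs IH] w w' ww' /=.
by rewrite !ww' //; congr (_ * _); apply: IH => k kG /=; exact: ww'.
Qed.

(** The product of the two lists around a factor of degree 0 has as many edges
    as the lists have entries. *)
Lemma cup_mid_local Gs1 (phi : pt -> int) Gs2 w w' :
  (forall k, (k <= size Gs1 + size Gs2)%N -> w k = w' k) ->
  let eta w := phi (w 0%N) * cup Gs2 (fun=> 1) w in
  cup Gs1 eta w = cup Gs1 eta w'.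
Proof.
move=> + eta; elim: Gs1 w w' => [|G Gs IH] w w' ww' /=.
  by rewrite /eta ww' //; congr (_ * _); exact: cup_local.
by rewrite !ww' //; congr (_ * _); apply: IH => k kG /=; exact: ww'.
Qed.

Lemma cup_quasi Gs eta w z : List.Forall quasi_periodic Gs ->
  periodic_cochain N eta ->
  cup Gs eta (fun k => w k + z *+ N) = cup Gs eta w.
Proof.
move=> + eta_per; elim: Gs w => [|G Gs IH] w /=.
  by move=> _; exact: eta_per.
case/List.Forall_cons_iff => [/(_ z)[a Ga] Gq].
rewrite !Ga; congr (_ * _); first by ring.
exact: (IH (w \o S)).
Qed.
End CupPeriodic.

Section DegreeOne.
Variables (m N : nat).
Hypothesis N_gt0 : (0 < N)%N.
Local Notation n := m.+1.
Local Notation pt := {ffun 'I_n -> int}.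
Implicit Types (u v z : pt) (s : 'S_n) (w : nat -> pt) (G : pt -> int).
Local Notation quasi := (@quasi_periodic n N).
Local Notation deg Gs := (@kuhn_sum n N (cup Gs (fun=> 1))).

Lemma kuhn_sum_cup_periodic Gs1 (phi : pt -> int) Gs2 :
  (size Gs1 + size Gs2 = m)%N ->
  List.Forall quasi Gs1 -> List.Forall quasi Gs2 ->
  periodic N phi -> deg (Gs1 ++ phi :: Gs2) = 0.
Proof.
move=> szG Gs1q Gs2q phi_per.
pose eta w := phi (w 0%N) * cup Gs2 (fun=> 1) w.
have eta_per : periodic_cochain N eta.
  by move=> w z; rewrite /eta phi_per cup_quasi.
transitivity ((-1) ^+ size Gs1 * kuhn_sum N (cobound m (cup Gs1 eta))).
  rewrite /kuhn_sum big_distrr /=; apply: eq_bigr => a _.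
  rewrite big_distrr /=; apply: eq_bigr => s _.
  by rewrite cup_cobound szG mulrCA.
rewrite kuhn_sum_cobound ?mulr0 //.
  by move=> w w' ww'; apply: cup_mid_local => k; rewrite szG => /ww'.
by move=> w z; exact: cup_quasi.
Qed.

(** The degree of a tuple of functions depends only on the classes of their
    differentials, one entry at a time. *)
Lemma deg_exchange Gs1 F X Gs2 :
  (size Gs1 + size Gs2 = m)%N ->
  List.Forall quasi Gs1 -> List.Forall quasi Gs2 ->
  periodic N (fun v => F v - X v) ->
  deg (Gs1 ++ F :: Gs2) = deg (Gs1 ++ X :: Gs2).
Proof.
move=> szG Gs1q Gs2q per; apply/eqP; rewrite -subr_eq0; apply/eqP.
rewrite -[RHS](kuhn_sum_cup_periodic szG Gs1q Gs2q per) /kuhn_sum -sumrB.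
apply: eq_bigr => a _; rewrite -sumrB; apply: eq_bigr => s _.
by rewrite cupB mulrBr.
Qed.

Definition coord (i : 'I_n) : pt -> int := fun v => v i.

Lemma coord_shift i v z : coord i (v + z *+ N) = coord i v + z i *+ N.
Proof. by rewrite /coord ffunE ffunMnE. Qed.

(** The lifts to [Z^n] of the maps from the torus to the circle that are
    homotopic to the [i]-th coordinate. *)
Definition equivariant i (F : pt -> int) :=
  forall v z, F (v + z *+ N) = F v + z i *+ N.

Lemma equivariant_quasi i F : equivariant i F -> quasi F.
Proof. by move=> Fi z; exists (z i *+ N) => v; rewrite Fi. Qed.

Lemma deg_coord (F : 'I_n -> pt -> int) : (forall i, equivariant i (F i)) ->
  deg [seq F i | i <- enum 'I_n] = deg [seq coord i | i <- enum 'I_n].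
Proof.
move=> Fi; have /= := size_enum_ord n.
rewrite -[map F _]cat0s -[map coord _]cat0s.
(* The entries are exchanged from left to right; the prefix, empty at first,
   holds those that are exchanged already. *)
have : List.Forall quasi [::] by [].
rewrite -[X in _ -> X = _ -> _]add0n.
rewrite -[X in (X + _)%N]/(size (@nil (pt -> int))).
elim: (enum 'I_n) [::] => [|i l IH] Gs Gsq /=; first by [].
rewrite addnS => -[szG].
have Gs2q : List.Forall quasi [seq F i | i <- l].
  elim: {IH szG} l => [|j l IH]; first by constructor.
  by constructor => //; exact: equivariant_quasi (Fi j).
rewrite (@deg_exchange _ _ (coord i)) ?size_map //; last first.
  by move=> v z; rewrite Fi coord_shift; ring.
rewrite -!cat_rcons; apply: IH; last by rewrite size_rcons; lia.
rewrite -cats1; apply/List.Forall_app; split=> //; constructor => //.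
by apply: (@equivariant_quasi i) => v z; exact: coord_shift.
Qed.

Lemma kuhn_coord u s (i j : 'I_n) :
  kuhn u s i.+1 j - kuhn u s i j = (j == s i)%:R.
Proof. by rewrite kuhnS !ffunE; ring. Qed.

(** Only the simplex with the standard order of the axes contributes in each
    cube. *)
Lemma deg_coordE : deg [seq coord i | i <- enum 'I_n] = (N ^ n)%:Z.
Proof.
rewrite /kuhn_sum.
transitivity (\sum_(a : {ffun 'I_n -> 'I_N}) (1 : int)); last first.
  by rewrite sumr_const card_ffun !card_ord -mulr_natr mul1r natz.
apply: eq_bigr => a _; rewrite (bigD1 1%g) //= odd_perm1 expr0 mul1r.
rewrite big1 ?addr0.
  rewrite (cup_prod _ (fun=> 0)) big1 // => k _.
  have kn : (k < n)%N.
    by apply: leq_trans (ltn_ord k) _; rewrite size_map size_enum_ord.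
  rewrite (nth_map ord0) ?size_enum_ord // /coord.
  by rewrite (kuhn_coord _ _ (Ordinal kn)) perm1 -val_eqE /=
    nth_enum_ord // eqxx.
move=> s s1; rewrite (cup_prod _ (fun=> 0)).
have [i si] : exists i, s i != i.
  apply/existsP; apply: contraR s1; rewrite negb_exists => /forallP s1.
  by apply/eqP/permP => i; rewrite perm1; apply/eqP; have := s1 i;
    rewrite negbK.
have iG : (i < size [seq coord i | i <- enum 'I_n])%N.
  by rewrite size_map size_enum_ord.
rewrite (bigD1 (Ordinal iG)) //= (nth_map ord0) ?size_enum_ord // /coord.
have := kuhn_coord (grid_pt a) s i i;
  rewrite eq_sym (negPf si) nth_ord_enum => ->.
by rewrite mul0r mulr0.
Qed.

End DegreeOne.

(** * No torus coloring trivializes one coordinate per color *)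

Section Coloring.
Variables (m N : nat).
Hypothesis N_gt0 : (0 < N)%N.
Local Notation n := m.+1.
Local Notation pt := {ffun 'I_n -> int}.
Variables (c : pt -> 'I_n) (h : pt -> int).
Hypothesis c_per : periodic N c.
Hypothesis h_equi : forall u z : pt, h (u + z *+ N) = h u + z (c u).
Hypothesis h_near : forall u u' : pt,
  (forall i, `|u i - u' i| <= 1) -> c u = c u' -> h u = h u'.

Definition in_cube (u v : pt) : Prop := forall j, v j = u j \/ v j = u j + 1.

(** The [i]-th coordinate, corrected near the cubes of color [i]. It does not
    depend on the chosen cube, since two cubes with a common vertex have the
    same label as soon as they have the same color. *)
Definition flatten_coord i (v : pt) : int :=
  if pselect (exists u, c u = i /\ in_cube u v) is left e
  then h (projT1 (cid e)) *+ N else v i.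

Lemma flatten_coord_cube i u v : c u = i -> in_cube u v ->
  flatten_coord i v = h u *+ N.
Proof.
move=> cu uv; rewrite /flatten_coord; case: pselect => [e|[]]; last by exists u.
case: cid => u' /= [cu' u'v]; congr (_ *+ N); apply: h_near; last by rewrite cu.
by move=> j; case: (uv j); case: (u'v j); lia.
Qed.

Lemma in_cubeD u v z : in_cube u v -> in_cube (u + z) (v + z).
Proof.
move=> uv j; rewrite !ffunE.
by case: (uv j) => ->; [left | right; rewrite addrAC].
Qed.

Lemma flatten_coord_equi i : equivariant N i (flatten_coord i).
Proof.
move=> v z; case: (pselect (exists u, c u = i /\ in_cube u v)) =>
  [[u [cu uv]]|no].
  rewrite (flatten_coord_cube cu uv).
  rewrite (@flatten_coord_cube i (u + z *+ N)) ?c_per //; last exact: in_cubeD.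
  by rewrite h_equi cu mulrnDl.
rewrite /flatten_coord; case: pselect => [e|_].
  case: no; case: e => u [cu uv]; exists (u + (- z) *+ N).
  by rewrite c_per; split=> //; rewrite -(addrK (z *+ N) v) -mulNrn;
    exact: in_cubeD.
by case: pselect => // _; exact: coord_shift.
Qed.

Lemma kuhn_in_cube u (s : 'S_n) k : in_cube u (kuhn u s k).
Proof.
move=> j; rewrite /kuhn ffunE sum_ffunE; under eq_bigr do rewrite ffunE.
rewrite (reindex_inj (@perm_inj _ s^-1%g)) /=.
under eq_bigr do rewrite permKV.
rewrite big_mkcond (bigD1 j) //= big1 ?addr0; last first.
  by move=> i ij; case: ifP => // _; rewrite eq_sym (negPf ij).
by rewrite eqxx; case: ifP => _; [right|left; rewrite addr0].
Qed.

(** On the cube at [u] the factor of index [c u] of the product vanishes, as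
    [flatten_coord (c u)] is constant there; the degree would be zero. *)
Theorem torus_coloring : False.
Proof.
have := deg_coordE m N; rewrite -(deg_coord N_gt0 flatten_coord_equi).
rewrite /kuhn_sum big1 => [/eqP|a _].
  by rewrite eq_sym eqz_nat expn_eq0; case: N N_gt0.
apply: big1 => s _; set u := grid_pt a.
rewrite (cup_prod _ (fun=> 0)).
have iG : (c u < size [seq flatten_coord i | i <- enum 'I_n])%N.
  by rewrite size_map size_enum_ord.
rewrite (bigD1 (Ordinal iG)) //= (nth_map ord0) ?size_enum_ord //.
rewrite nth_ord_enum !(flatten_coord_cube (erefl (c u)) (kuhn_in_cube _ _ _)).
by rewrite subrr mul0r mulr0.
Qed.

End Coloring.

(** * The category of the torus *)

Section TorusCover.
Variables (R : realType) (m : nat).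
Local Notation n := m.+1.
Local Notation pt := {ffun 'I_n -> int}.
Local Notation vec := 'rV[R]_n.

Implicit Types (x y : vec) (z : pt).

Definition lattice_pt (z : pt) : vec := \row_j (z j)%:~R.

Definition close (r : R) (x y : vec) := forall j, `|x ord0 j - y ord0 j| < r.

(** Near a point [x] one can take [x] itself as center, for all small [rho];
    compactness of the cube makes [rho] uniform. *)
Lemma lebesgue_number (r : vec -> R) : (forall x, 0 < r x) ->
  exists2 rho, 0 < rho & forall x : vec, (forall j, 0 <= x ord0 j <= 1) ->
    exists2 a, rho <= r a & close (r a / 4) a x.
Proof.
move=> r_gt0; pose K : set vec :=
  [set v | forall j, `[0, 1]%classic (v ord0 j)].
have K_compact : compact K.
  exact: (@rV_compact R n (fun=> `[0, 1]%classic)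
    (fun=> @segment_compact R 0 1)).
have /compact_near_coveringP/(_ R (0^'+)
  (fun rho (x : vec) => exists2 a, rho <= r a & close (r a / 4) a x)) cov :=
    K_compact.
have : \forall rho \near 0^'+, K `<=`
    (fun x : vec => exists2 a, rho <= r a & close (r a / 4) a x).
  apply: cov => x _.
  have r4 : 0 < r x / 4 by rewrite divr_gt0.
  exists (ball x (r x / 4), [set rho | rho <= r x]).
    split => /=; first exact: nbhsx_ballx.
    by apply: nbhs_right_le.
  by case=> y rho /= [[_ xy] rho_le]; exists x => // j; exact: (xy ord0 j).
move=> near_rho.
have [rho [rho_gt0 Krho]] : exists rho, 0 < rho /\ K `<=`
    (fun x : vec => exists2 a, rho <= r a & close (r a / 4) a x).
  near (0 : R)^'+ => rho; exists rho; split; first by [].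
  by near: rho.
exists rho => // x x01; apply: Krho => j /=; rewrite in_itv /=; exact: x01.
Unshelve. all: by end_near. Qed.

Variables (A : 'I_n -> set vec) (g : 'I_n -> vec -> int).
Hypothesis A_cover : forall x, exists i, A i x.
Hypothesis A_per : forall i x z, A i x -> A i (x + lattice_pt z).
Hypothesis g_equi : forall i x z, A i x -> g i (x + lattice_pt z) = g i x + z i.
Hypothesis g_loc : forall i x, A i x ->
  exists2 r, 0 < r & forall y, close r x y -> A i y -> g i y = g i x.

(** The cubes of a grid of mesh less than [rho / 4] are colored by choosing, for
    each grid point of the fundamental cube, a center whose ball contains it.
    The centers of adjacent cubes of one color are then so close that the
    larger of the two balls contains both, and the label is the same. *)
Theorem torus_cover : False.
Proof.
pose col x := projT1 (cid (A_cover x)).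
have colP x : A (col x) x by exact: (projT2 (cid (A_cover x))).
have [r r_gt0 rP] : exists2 r : vec -> R, forall x, 0 < r x & forall x y,
    close (r x) x y -> A (col x) y -> g (col x) y = g (col x) x.
  pose r x := projT1 (cid2 (g_loc (colP x))).
  by exists r => [x|x y]; rewrite /r; case: cid2 => //= r0 r0_gt0 r0P;
    exact: r0P.
have [rho rho_gt0 rhoP] := lebesgue_number r_gt0.
pose N := (Num.truncn (4 / rho)).+1.
have N_gt0 : (0 < N)%N by [].
have NR_gt0 : 0 < N%:R :> R by rewrite ltr0n.
have rhoN : N%:R^-1 < rho / 4.
  rewrite -[ltRHS]invrK ltf_pV2 ?posrE ?invr_gt0 ?divr_gt0 // invf_div.
  exact: truncnS_gt.
have N_neq0 : N%:Z != 0 by [].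
(* The grid point [u], scaled by [1 / N], is the sum of the lattice point [zu u]
   and of the point [p u] of the fundamental cube. *)
pose zu (u : pt) : pt := [ffun j => (u j %/ N%:Z)%Z].
pose p (u : pt) : vec := \row_j ((u j %% N%:Z)%Z%:~R / N%:R).
have p01 u j : 0 <= p u ord0 j <= 1.
  rewrite mxE divr_ge0 ?ler0z ?modz_ge0 //= ler_pdivrMr // mul1r.
  by rewrite -[N%:R]/(N%:Z%:~R) ler_int ltW // ltz_pmod.
pose a u := projT1 (cid2 (rhoP _ (p01 u))).
have a_rho u : rho <= r (a u) by rewrite /a; case: cid2.
have a_close u : close (r (a u) / 4) (a u) (p u) by rewrite /a; case: cid2.
have aD u z : a (u + z *+ N) = a u.
  have pD : p (u + z *+ N) = p u.
    apply/rowP => j; rewrite !mxE ffunE ffunMnE.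
    by rewrite addrC -[z j *+ N]mulr_natr natz modzMDl.
  rewrite /a; move: (p01 (u + z *+ N)) (p01 u); rewrite pD => h1 h2.
  by rewrite (Prop_irrelevance h1 h2).
have zuD u z : zu (u + z *+ N) = zu u + z.
  apply/ffunP => j; rewrite !ffunE ffunMnE addrC -[z j *+ N]mulr_natr natz.
  by rewrite divzMDl // addrC.
apply: (@torus_coloring m N N_gt0 (fun u => col (a u))
   (fun u => g (col (a u)) (a u) + zu u (col (a u)))).
- by move=> u z; rewrite aD.
- by move=> u z; rewrite aD zuD ffunE addrA.
move=> u u'.
wlog rr : u u' / r (a u') <= r (a u).
  move=> H uu' cc.
  have [|/ltW] := leP (r (a u')) (r (a u)); first by move/H; exact.
  by move/H => -> // i; rewrite distrC.
move=> uu' cc.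
(* The center of [u'], seen from the copy of the fundamental cube of [u]. *)
pose y := a u' + lattice_pt (zu u' - zu u).
have Ay : A (col (a u)) y by apply: A_per; rewrite cc.
have : g (col (a u)) y = g (col (a u)) (a u).
  apply: rP => // j.
  have := a_close u j; have := a_close u' j; have := uu' j.
  have := a_rho u.
  rewrite !mxE !ffunE.
  have uE (v : pt) : (v j %% N%:Z)%Z%:~R / N%:R =
      (v j)%:~R / N%:R - (v j %/ N%:Z)%Z%:~R :> R.
    have -> : (v j)%:~R = (v j %/ N%:Z)%Z%:~R * N%:R + (v j %% N%:Z)%Z%:~R :> R.
      by rewrite -[N%:R]/(N%:Z%:~R) -intrM -intrD -divz_eq.
    by field; rewrite pnatr_eq0.
  rewrite !uE.
  rewrite -(ler_int R) intr_norm intrB -(ler_pM2r (x := N%:R^-1)) ?invr_gt0 //.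
  rewrite -[X in _ * X <= _](gtr0_norm (x := N%:R^-1)) ?invr_gt0 //.
  rewrite -normrM mulrBl mul1r !intrD intrN ler_norml !ltr_norml.
  set X := _ / _; set X' := _ / _ => *.
  lra.
rewrite g_equi; last by rewrite cc.
by rewrite !ffunE cc => <-; ring.
Qed.

End TorusCover.

(** * Angles on the circle *)

Section Circle.
Variable R : realType.
Local Notation C := (R * R)%type.
Implicit Types (z w : C) (t x : R).

(** Angles are measured in turns, so that the fibers are cosets of [Z]. *)
Definition expi x : C := (cos (x * (pi *+ 2)), sin (x * (pi *+ 2))).
Definition dot z w : R := z.1 * w.1 + z.2 * w.2.

(** On the circle, the imaginary part of [w / z], of which [dot] is the real
    part. *)
Definition cross z w : R := z.1 * w.2 - z.2 * w.1.
Definition on_circle z : Prop := dot z z = 1.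

(** The principal angle from [z] to [w]; meaningful when [dot z w > 0]. *)
Definition angle z w : R := asin (cross z w) / (pi *+ 2).

Lemma pi2_neq0 : pi *+ 2 != 0 :> R.
Proof. by rewrite mulrn_eq0 /= gt_eqF ?pi_gt0. Qed.

Lemma expi_circle x : on_circle (expi x).
Proof. by rewrite /on_circle /dot /= -!expr2 cos2Dsin2. Qed.

Lemma expiD x y : expi (x + y) =
  ((expi x).1 * (expi y).1 - (expi x).2 * (expi y).2,
   (expi x).1 * (expi y).2 + (expi x).2 * (expi y).1).
Proof. by rewrite /expi /= mulrDl cosD sinD; congr (_, _); ring. Qed.

Lemma dot_cross z w : on_circle z -> on_circle w ->
  dot z w ^+ 2 + cross z w ^+ 2 = 1.
Proof.
rewrite /on_circle /dot /cross => hz hw.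
transitivity ((z.1 * z.1 + z.2 * z.2) * (w.1 * w.1 + w.2 * w.2)); first by ring.
by rewrite hz hw mulr1.
Qed.

Lemma cross_lt1 z w : on_circle z -> on_circle w -> 0 < dot z w ->
  -1 < cross z w < 1.
Proof. by move=> hz hw d0; have := dot_cross hz hw; nra. Qed.

Lemma expi_angle z w : on_circle z -> on_circle w -> 0 < dot z w ->
  expi (angle z w) = (dot z w, cross z w).
Proof.
move=> hz hw d0; rewrite /expi /angle mulfVK ?pi2_neq0 //.
have c1 : -1 <= cross z w <= 1.
  by have /andP[? ?] := cross_lt1 hz hw d0; rewrite !ltW.
rewrite cos_asin // asinK ?in_itv //=; congr (_, _).
rewrite -[RHS]ger0_norm ?ltW // -sqrtr_sqr; congr Num.sqrt.
by rewrite -(dot_cross hz hw); ring.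
Qed.

Lemma expi_add_angle x z w : expi x = z -> on_circle w -> 0 < dot z w ->
  expi (x + angle z w) = w.
Proof.
move=> xz hw d0; have hz : on_circle z by rewrite -xz; exact: expi_circle.
rewrite expiD xz expi_angle //=; move: hz; rewrite /on_circle /dot /cross.
case: w {hw d0} => w1 w2 /= hz; congr (_, _).
  transitivity ((z.1 * z.1 + z.2 * z.2) * w1); [by ring | by rewrite hz mul1r].
transitivity ((z.1 * z.1 + z.2 * z.2) * w2); [by ring | by rewrite hz mul1r].
Qed.

Lemma angle_expi x y : `|y - x| < 1 / 4 -> angle (expi x) (expi y) = y - x.
Proof.
move=> xy; rewrite /angle /cross /= [X in asin X](_ : _ =
  sin ((y - x) * (pi *+ 2))).
  rewrite sinK ?mulfK ?pi2_neq0 // in_itv /=.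
  have := pi_gt0 R; move: xy; rewrite ltr_norml => /andP[? ?] ?.
  by apply/andP; split; nra.
by rewrite mulrBl sinB; ring.
Qed.

Lemma expi_int (k : int) : expi k%:~R = (1, 0).
Proof.
have nat_case (n : nat) : expi n%:R = (1, 0).
  rewrite /expi mulr_natl -[pi *+ 2 *+ n]add0r.
  by rewrite (periodicn (@cosD2pi R)) (periodicn (@sinD2pi R)) cos0 sin0.
case: k => n; first exact: nat_case.
rewrite NegzE intrN /expi mulNr cosN sinN.
by case: (nat_case n.+1) => -> ->; rewrite oppr0.
Qed.

Lemma expiDint x (k : int) : expi (x + k%:~R) = expi x.
Proof. by rewrite expiD expi_int; case: (expi x) => a b /=; congr (_, _);
  ring. Qed.

Lemma expi_eq1 x : expi x = (1, 0) -> exists k : int, x = k%:~R.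
Proof.
move=> x1; exists (Num.floor x).
set y := x - (Num.floor x)%:~R.
have y01 : 0 <= y < 1 by rewrite subr_ge0 floor_le ltrBlDr addrC -intrD1
  floorD1_gt.
have : expi y = (1, 0) by rewrite -x1 -(expiDint x (- Num.floor x)) intrN.
case=> cy _; apply/eqP; rewrite -subr_eq0; apply/eqP.
rewrite -/y; apply/eqP; case/andP: y01 => y0 y1.
rewrite eq_le y0 andbT leNgt; apply/negP => y_gt0.
have : 0 < sin (y * pi).
  by apply: sin_gt0_pi; rewrite mulr_gt0 ?pi_gt0 //= gtr_pMl ?pi_gt0.
have : cos (y * (pi *+ 2)) = 1 - sin (y * pi) ^+ 2 *+ 2.
  by rewrite mulrnAr cos_mulr2n cos2sin2; ring.
by rewrite cy; nra.
Qed.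

Lemma expi_eq x y : expi x = expi y -> exists k : int, x = y + k%:~R.
Proof.
move=> xy; have [k xyk] : exists k : int, x - y = k%:~R.
  apply: expi_eq1; rewrite expiD xy /expi /= mulNr cosN sinN.
  by rewrite mulrN opprK mulrN -!expr2 cos2Dsin2; congr (_, _); ring.
by exists k; rewrite -xyk; ring.
Qed.

Definition base : C := (1, 0).

Lemma base_circle : on_circle base.
Proof. by rewrite /on_circle /dot /= mulr1 mulr0 addr0. Qed.

End Circle.

(** * Path lifting *)

Lemma cvg_pair1 (T : Type) (U V : topologicalType) (Fi : set_system T)
  (f : T -> U * V) (z : U * V) : Filter Fi -> f @ Fi --> z -> (f x).1 @[x -->
    Fi] --> z.1.
Proof. by move=> FF fz; apply: (cvg_comp _ _ fz); exact: cvg_fst. Qed.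

Lemma cvg_pair2 (T : Type) (U V : topologicalType) (Fi : set_system T)
  (f : T -> U * V) (z : U * V) : Filter Fi -> f @ Fi --> z -> (f x).2 @[x -->
    Fi] --> z.2.
Proof. by move=> FF fz; apply: (cvg_comp _ _ fz); exact: cvg_snd. Qed.

Lemma cvg_to_pair (T : Type) (U V : topologicalType) (Fi : set_system T)
  (f : T -> U * V) (z : U * V) : Filter Fi ->
  (f x).1 @[x --> Fi] --> z.1 -> (f x).2 @[x --> Fi] --> z.2 -> f @ Fi --> z.
Proof.
case: z => a b FF fa fb.
have -> : f = fun x => ((f x).1, (f x).2) by apply/funext => x; case: (f x).
exact: cvg_pair.
Qed.

Section CvgReal.
Variables (R : realType) (T : Type) (Fi : set_system T).
Context {FF : Filter Fi}.
Implicit Types (f g : T -> R) (a b : R).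

Lemma cvg_min f g a b : f @ Fi --> a -> g @ Fi --> b ->
  Num.min (f x) (g x) @[x --> Fi] --> Num.min a b.
Proof.
move=> fa gb; rewrite minr_absE.
under eq_cvg do rewrite minr_absE.
apply: cvgM; last exact: cvg_cst.
by apply: cvgB; [exact: cvgD | apply: cvg_norm; exact: cvgB].
Qed.

Lemma cvg_max f g a b : f @ Fi --> a -> g @ Fi --> b ->
  Num.max (f x) (g x) @[x --> Fi] --> Num.max a b.
Proof.
move=> fa gb; rewrite maxr_absE.
under eq_cvg do rewrite maxr_absE.
apply: cvgM; last exact: cvg_cst.
by apply: cvgD; [exact: cvgD | apply: cvg_norm; exact: cvgB].
Qed.

Lemma cvg_sumr (I : Type) (r : seq I) (h : I -> T -> R) (l : I -> R) :
  (forall i, h i @ Fi --> l i) ->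
  \sum_(i <- r) h i x @[x --> Fi] --> \sum_(i <- r) l i.
Proof. by move=> hl; apply: cvg_big => // ; exact: add_continuous. Qed.
End CvgReal.

Section Lift.
Variable R : realType.
Local Notation C := (R * R)%type.
Implicit Types (z w : C) (t x : R).

Section Cvg.
Variables (T : Type) (Fi : set_system T).
Context {FF : Filter Fi}.
Implicit Types f g : T -> C.

Lemma cvg_dot f g z w : f @ Fi --> z -> g @ Fi --> w ->
  dot (f x) (g x) @[x --> Fi] --> dot z w.
Proof.
move=> fz gw; apply: cvgD; apply: cvgM;
  [exact: cvg_pair1 fz|exact: cvg_pair1 gw|
  exact: cvg_pair2 fz|exact: cvg_pair2 gw].
Qed.

Lemma cvg_cross f g z w : f @ Fi --> z -> g @ Fi --> w ->
  cross (f x) (g x) @[x --> Fi] --> cross z w.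
Proof.
move=> fz gw; apply: cvgB; apply: cvgM;
  [exact: cvg_pair1 fz|exact: cvg_pair2 gw|
  exact: cvg_pair2 fz|exact: cvg_pair1 gw].
Qed.

Lemma cvg_angle f g z w : f @ Fi --> z -> g @ Fi --> w ->
  on_circle z -> on_circle w -> 0 < dot z w ->
  angle (f x) (g x) @[x --> Fi] --> angle z w.
Proof.
move=> fz gw hz hw d0; apply: cvgM; last exact: cvg_cst.
apply: (cvg_comp _ _ (cvg_cross fz gw)).
by apply: continuous_asin; exact: cross_lt1.
Qed.
End Cvg.

(** Otherwise the intermediate value theorem gives a value that lies halfway
    between two consecutive integers. *)
Lemma int_valued_cst (d : R -> R) : continuous d ->
  (forall t, 0 <= t <= 1 -> exists k : int, d t = k%:~R) -> d 0 = d 1.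
Proof.
move=> dc dint.
have [k0 d0] := dint 0 ltac:(lra); have [k1 d1] := dint 1 ltac:(lra).
apply/eqP/negPn/negP => d01.
have k01 : k0 != k1 by apply: contra d01 => /eqP k01; rewrite d0 d1 k01.
have [c c01 dcv] : exists2 c, c \in `[0, 1] & d c =
  (Order.min k0 k1)%:~R + 1 / 2.
  apply: IVT => //; first by apply/continuous_subspaceT.
  rewrite d0 d1 minElt maxElt; move: k01; rewrite !ltr_int.
  case: ltgtP => // k01 _.
    have ? : k0%:~R + 1 <= k1%:~R :> R by rewrite -intrD1 ler_int; lia.
    by apply/andP; split; lra.
  have ? : k1%:~R + 1 <= k0%:~R :> R by rewrite -intrD1 ler_int; lia.
  by apply/andP; split; lra.
move: c01; rewrite in_itv /= => /dint[k]; rewrite dcv => ck.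
have : (Order.min k0 k1) < k by rewrite -(ltr_int R) -ck; lra.
have : k < (Order.min k0 k1) + 1 by rewrite -(ltr_int R) intrD1 -ck; lra.
lia.
Qed.

(** The difference of the two lifts, corrected by the angle between the two
    paths, is an integer at all times. *)
Lemma lift_unique (gam gam' : R -> C) (L L' : R -> R) :
  continuous gam -> continuous gam' -> continuous L -> continuous L' ->
  (forall t, expi (L t) = gam t) -> (forall t, expi (L' t) = gam' t) ->
  (forall t, 0 < dot (gam t) (gam' t)) ->
  L' 1 - L 1 - angle (gam 1) (gam' 1) = L' 0 - L 0 - angle (gam 0) (gam' 0).
Proof.
move=> gc gc' Lc Lc' Lg Lg' d0; apply/esym.
have circ t : on_circle (gam t) by rewrite -Lg; exact: expi_circle.
have circ' t : on_circle (gam' t) by rewrite -Lg'; exact: expi_circle.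
apply: (int_valued_cst (d := fun t => L' t - L t - angle (gam t) (gam' t))).
  move=> t; apply: cvgB; first by apply: cvgB; [exact: Lc'|exact: Lc].
  by apply: cvg_angle; [exact: gc|exact: gc'|..].
move=> t _; have [k Lk] : exists k : int, L' t =
  L t + angle (gam t) (gam' t) + k%:~R.
  apply: expi_eq; rewrite Lg'; apply/esym; exact: expi_add_angle.
by exists k; rewrite Lk; ring.
Qed.

Lemma path_subdivision (gam : R -> C) : continuous gam ->
  (forall t, on_circle (gam t)) ->
  exists m : nat, forall t t', 0 <= t <= 1 -> 0 <= t' <= 1 ->
    `|t - t'| <= m.+1%:R^-1 -> 0 < dot (gam t) (gam t').
Proof.
move=> gc circ.
have /compact_near_coveringP/(_ R (0^'+)
  (fun e t => forall t', `|t - t'| <= e -> 0 < dot (gam t) (gam t'))) cov :=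
  @segment_compact R 0 1.
have [e [e_gt0 He]] : exists e, 0 < e /\ `[0, 1]%classic `<=`
    (fun t => forall t', `|t - t'| <= e -> 0 < dot (gam t) (gam t')).
  have near_e : \forall e \near 0^'+, `[0, 1]%classic `<=`
      (fun t => forall t', `|t - t'| <= e -> 0 < dot (gam t) (gam t')).
    apply: cov => t0 _.
    have : \forall p \near (t0, t0), 0 < dot (gam p.1) (gam p.2).
      have : dot (gam p.1) (gam p.2) @[p --> (t0, t0)] -->
        dot (gam t0) (gam t0).
        apply: cvg_dot.
          by apply: (cvg_comp _ _ (@cvg_fst _ _ (nbhs t0) (nbhs t0) _));
            exact: gc.
        by apply: (cvg_comp _ _ (@cvg_snd _ _ (nbhs t0) (nbhs t0) _));
          exact: gc.
      by move/cvgr_gt; apply; rewrite circ.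
    case=> -[U V] /= [] /nbhs_ballP[r /= r0 rU] /nbhs_ballP[s /= s0 sV] UV.
    pose q := Num.min r s / 2.
    have q0 : 0 < q by rewrite divr_gt0 // lt_min r0 s0.
    have qr : q *+ 2 <= r.
      by rewrite -mulr_natr /q divfK ?pnatr_eq0 // ge_min lexx.
    have qs : q *+ 2 <= s.
      by rewrite -mulr_natr /q divfK ?pnatr_eq0 // ge_min lexx orbT.
    exists (ball t0 q, [set e | e <= q]).
      by split => /=; [exact: nbhsx_ballx | exact: nbhs_right_le].
    case=> t e /= []; rewrite -ball_normE /= ltr_norml => /andP[? ?] eq t'.
    rewrite ler_norml => /andP[? ?]; apply: (UV (t, t')); split => /=.
      by apply: rU; rewrite -ball_normE /= ltr_norml; lra.
    by apply: sV; rewrite -ball_normE /= ltr_norml; lra.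
  near (0 : R)^'+ => e; exists e; split; first by [].
  by near: e.
exists (Num.truncn e^-1) => t t' t01 _ tt'; apply: He => //=.
apply: (le_trans tt'); rewrite -[leRHS]invrK lef_pV2 ?posrE ?invr_gt0 //.
by rewrite ltW // truncnS_gt.
Unshelve. all: by end_near. Qed.

Definition clamp t : R := Num.max 0 (Num.min t 1).

Lemma clamp01 t : 0 <= clamp t <= 1.
Proof. by rewrite /clamp le_max lexx ge_max ler01 ge_min lexx orbT. Qed.

Lemma clamp_id t : 0 <= t <= 1 -> clamp t = t.
Proof. by case/andP=> t0 t1; rewrite /clamp min_l // max_r. Qed.

Lemma continuous_clamp : continuous clamp.
Proof.
move=> t; apply: cvg_max; first exact: cvg_cst.
by apply: cvg_min; [exact: cvg_id|exact: cvg_cst].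
Qed.

Lemma angle_refl (z : C) : angle z z = 0.
Proof.
rewrite /angle /cross [z.2 * _]mulrC subrr -[X in asin X]sin0 sinK ?mul0r //
  in_itv /=.
by rewrite oppr_le0 divr_ge0 ?pi_ge0.
Qed.

Lemma dist_min_le (c q d : R) : 0 <= d ->
  `|Num.min c q - Num.min c (q + d)| <= d.
Proof.
move=> d0; rewrite !minElt; case: (ltP c q) => ?; case: (ltP c (q + d)) => ?.
all: by rewrite ler_norml; lra.
Qed.

(** The path is cut into pieces on which the angle to the starting point of the
    piece is defined, and [L] is the sum of the angles swept on the pieces,
    each stopped at time [t]; no gluing is necessary. *)
Lemma lift_exists (gam : R -> C) x0 : continuous gam ->
  (forall t, on_circle (gam t)) -> expi x0 = gam 0 ->
  exists L : R -> R, [/\ continuous L, L 0 = x0 &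
    forall t, expi (L t) = gam (clamp t)].
Proof.
move=> gc circ gx0; have [m mP] := path_subdivision gc circ.
pose b (k : nat) t := Num.min (clamp t) (k%:R / m.+1%:R).
have b01 k t : 0 <= b k t <= 1.
  have /andP[c0 c1] := clamp01 t.
  by rewrite le_min ge_min c0 c1 divr_ge0.
have bS k t : `|b k t - b k.+1 t| <= m.+1%:R^-1.
  rewrite /b -[k.+1%:R]natr1 mulrDl mul1r; apply: dist_min_le.
  by rewrite invr_ge0.
have bc k : continuous (b k).
  by move=> t; apply: cvg_min; [exact: continuous_clamp|exact: cvg_cst].
have gbc k : continuous (gam \o b k).
  by move=> t; apply: continuous_comp; [exact: bc|exact: gc].
pose L k t := x0 + \sum_(i < k) angle (gam (b i t)) (gam (b i.+1 t)).
have LP k t : expi (L k t) = gam (b k t).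
  elim: k => [|k IH].
    rewrite /L big_ord0 addr0 gx0 /b mul0r min_r //.
    by case/andP: (clamp01 t).
  by rewrite /L big_ord_recr /= addrA; apply: expi_add_angle => //; exact: mP.
exists (L m.+1); split.
- move=> t; apply: cvgD; first exact: cvg_cst.
  apply: cvg_sumr => i; apply: cvg_angle => //;
    [exact: gbc|exact: gbc|exact: mP].
- rewrite /L big1 ?addr0 // => i _.
  have b0 k : b k 0 = 0.
    by rewrite /b clamp_id ?lexx ?ler01 // min_l // divr_ge0.
  by rewrite !b0 angle_refl.
- move=> t; rewrite LP /b divff ?pnatr_eq0 // min_l //.
  by case/andP: (clamp01 t).
Qed.

End Lift.

(** * Integer labels from null-homotopies of a coordinate *)

Section Label.
Variables (R : realType) (m : nat).
Local Notation n := m.+1.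
Local Notation pt := {ffun 'I_n -> int}.
Local Notation vec := 'rV[R]_n.
Local Notation C := (R * R)%type.
Implicit Types (x y : vec) (z : pt) (t : R).

(** The label of [x] is the end point of the lift that starts at [x_i] of a
    path from the [i]-th circle coordinate of [x] to the base point. It is an
    integer; it shifts with [x] since the path does not change under lattice
    translations; and it is locally constant since nearby paths have nearby
    lifts. *)
Lemma contraction_label (A : set vec) (i : 'I_n) (gam : vec -> R -> C) :
  (forall x z, A x -> A (x + lattice_pt R z)) ->
  (forall x z, A x -> gam (x + lattice_pt R z) = gam x) ->
  (forall x, A x -> continuous (gam x)) ->
  (forall x, A x -> forall t, on_circle (gam x t)) ->
  (forall x, A x -> gam x 0 = expi (x ord0 i)) ->
  (forall x, A x -> gam x 1 = (1, 0)) ->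
  (forall x, A x -> exists2 r, 0 < r & forall y, close r x y -> A y ->
     forall t, 0 <= t <= 1 -> 0 < dot (gam x t) (gam y t)) ->
  exists g : vec -> int,
    (forall x z, A x -> g (x + lattice_pt R z) = g x + z i) /\
    (forall x, A x -> exists2 r, 0 < r &
       forall y, close r x y -> A y -> g y = g x).
Proof.
move=> A_per gam_per gam_c gam_circ gam0 gam1 gam_near.
have lift x : exists k : int, A x -> exists L : R -> R, [/\ continuous L,
    L 0 = x ord0 i, L 1 = k%:~R & forall t, expi (L t) = gam x (clamp t)].
  case: (pselect (A x)) => [Ax|nAx]; last by exists 0.
  have [L [Lc L0 LP]] :=
    lift_exists (gam_c x Ax) (gam_circ x Ax) (esym (gam0 x Ax)).
  have [k L1] : exists k : int, L 1 = k%:~R.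
    by apply: expi_eq1; rewrite LP clamp_id ?ler01 ?lexx // gam1.
  by exists k => _; exists L.
pose g x := projT1 (cid (lift x)).
have gP x : A x -> exists L : R -> R, [/\ continuous L,
    L 0 = x ord0 i, L 1 = (g x)%:~R & forall t, expi (L t) = gam x (clamp t)].
  by rewrite /g; case: cid.
have gc x : A x -> continuous (gam x \o @clamp R).
  move=> Ax t; apply: continuous_comp; [exact: continuous_clamp|exact: gam_c].
have diff x y : A x -> A y ->
    (forall t, 0 <= t <= 1 -> 0 < dot (gam x t) (gam y t)) ->
    (g y)%:~R - (g x)%:~R =
    y ord0 i - x ord0 i - angle (expi (x ord0 i)) (expi (y ord0 i)).
  move=> Ax Ay xy; have [L [Lc L0 L1 LP]] := gP x Ax.
  have [L' [Lc' L0' L1' LP']] := gP y Ay.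
  have := lift_unique (gc x Ax) (gc y Ay) Lc Lc' LP LP'.
  rewrite /= !clamp_id ?lexx ?ler01 // L0 L0' L1 L1' !gam0 // !gam1 //.
  rewrite angle_refl subr0; apply => t; apply: xy; exact: clamp01.
exists g; split=> [x z Ax|x Ax].
  have := diff x (x + lattice_pt R z) Ax (A_per _ _ Ax); rewrite gam_per //.
  rewrite !mxE expiDint angle_refl subr0 => H.
  apply/eqP; rewrite -(eqr_int R) intrD; apply/eqP.
  suff : (g (x + lattice_pt R z))%:~R - (g x)%:~R =
    x ord0 i + (z i)%:~R - x ord0 i.
    by lra.
  by apply: H => t _; rewrite (gam_circ x Ax).
have [r r0 rP] := gam_near x Ax.
(* Below a quarter turn, [angle] recovers the difference of the coordinates. *)
exists (Num.min r (1 / 4)); first by rewrite lt_min r0 divr_gt0.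
move=> y xy Ay; apply/eqP; rewrite -(eqr_int R) -subr_eq0.
rewrite diff //; last first.
  by apply: rP => // j; have := xy j; rewrite lt_min => /andP[].
rewrite angle_expi ?subrr //; have := xy i.
by rewrite lt_min distrC => /andP[].
Qed.

End Label.

(** * Subspaces, products and path spaces *)

Section Subtype.
Variables (X : topologicalType) (A : set X).

Lemma cvg_subtype (T : Type) (Fi : set_system T) (f : T -> A) (a : A) :
  Filter Fi -> (\val (f x) @[x --> Fi] --> \val a) -> f @ Fi --> a.
Proof.
move=> FF fa U [_ [[W oW <-] /= Wa] WU].
apply: (filterS WU); apply: fa; exact: open_nbhs_nbhs.
Qed.

Lemma continuous_subtype (T : topologicalType) (f : T -> A) :
  continuous (fun t => \val (f t)) -> continuous f.
Proof. by move=> fc t; apply: (@cvg_subtype _ (nbhs t)); exact: fc. Qed.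

Lemma continuous_val : continuous (\val : A -> X).
Proof. exact: initial_continuous. Qed.
End Subtype.

Lemma cvg_prod (I : Type) (K : I -> topologicalType) (T : Type)
  (Fi : set_system T) (f : T -> prod_topology K) (a : prod_topology K) :
  Filter Fi -> (forall i, f x i @[x --> Fi] --> a i) -> f @ Fi --> a.
Proof.
move=> FF fa; apply/cvg_sup => i U [_ [[W oW <-] /= Wa] WU].
apply: (filterS WU); apply: fa; exact: open_nbhs_nbhs.
Qed.

Lemma continuous_coord (I : eqType) (K : I -> topologicalType) (i : I) :
  continuous (fun x : prod_topology K => x i).
Proof. exact: proj_continuous. Qed.

Section Interval.
Variable R : realType.
Local Notation I := (@unit_interval R).

Lemma clamp_in (t : R) : clamp t \in I.
Proof. by apply/mem_set; rewrite /unit_interval /= in_itv /= clamp01. Qed.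

Definition clampI (t : R) : I := exist _ (clamp t) (clamp_in t).

Lemma continuous_clampI : continuous clampI.
Proof. by move=> t; apply: cvg_subtype; exact: continuous_clamp. Qed.

Lemma interval01 (t : I) : 0 <= \val t <= 1.
Proof. by case: t => t /= /set_mem; rewrite /unit_interval /= in_itv. Qed.

Lemma clampI_val (t : I) : clampI (\val t) = t.
Proof. by apply: val_inj; rewrite /= clamp_id // interval01. Qed.

Lemma interval_compact : compact [set: I].
Proof.
have -> : [set: I] = clampI @` `[0, 1]%classic.
  apply/seteqP; split=> // t _; exists (\val t); last exact: clampI_val.
  by rewrite /= in_itv /= interval01.
apply: continuous_compact; last exact: segment_compact.
by apply: continuous_subspaceT; exact: continuous_clampI.
Qed.

Lemma clampI0 : clampI 0 = @I0 R.
Proof. by apply: val_inj; rewrite /= clamp_id // lexx ler01. Qed.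

Lemma clampI1 : clampI 1 = @I1 R.
Proof. by apply: val_inj; rewrite /= clamp_id // lexx ler01. Qed.

(** Exponential law: the unit interval is compact and regular. *)
Lemma continuous_path_eval (T X : topologicalType) (s : T -> path_space R X) :
  continuous s -> continuous (fun p : T * I => path_fun (s p.1) p.2).
Proof.
move=> sc; pose f (p : T) : I -> X := path_fun (s p).
rewrite [X in continuous X](_ : _ = uncurry f); last by apply/funext => -[].
apply: continuous_uncurry_regular.
- by move=> t _; exists setT; [exact: filterT|split;
  [exact: interval_compact|exact: closedT]].
- exact: uniform_regular.
- move=> p; apply: (@continuous_comp _ _ _ s (@path_fun R X)); first exact: sc.
  exact: initial_continuous.
- by move=> p; exact: (@cts_fun _ _ (s p)).
Qed.

Lemma continuous_path_curry (T X : topologicalType) (H : T * I -> X) :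
  continuous H -> exists2 s : T -> path_space R X, continuous s &
    forall p t, path_fun (s p) t = H (p, t).
Proof.
move=> Hc; have [Hcurry Hp] := continuous_curry Hc.
pose s p : path_space R X := mkcts (Hp p).
exists s => //; apply: continuous_comp_initial; exact: Hcurry.
Qed.

End Interval.

(** * Points of the graph complex, and planners as null-homotopies *)

Section GraphPoints.
Variables (R : realType) (V : finType) (E : {set {set V}}).
Local Notation X := (X_graph R E).
Local Notation C := (R * R)%type.

Lemma clique_subset (K J : {set V}) :
  (J \subset K)%SET -> is_clique E K -> is_clique E J.
Proof.
move=> /fintype.subsetP JK /'forall_implyP KE.
apply/'forall_implyP => x /JK xK; apply/'forall_implyP => y /JK yK.
by have /'forall_implyP/(_ y yK) := KE x xK.
Qed.

(** Cliques are stable under subsets, so a clique that contains the support is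
    enough. *)
Lemma X_graphP (x : torus R V) : X x <->
  exists2 K : {set V}, is_clique E K & forall v, v \notin K -> x v = circle_e R.
Proof.
split=> [[J /= JE xJ]|[K KE xK]].
  by exists J => [|v vJ]; [move: JE; rewrite inE | exact: (xJ v).1].
exists [set v | `[< x v <> circle_e R >]]%SET.
  rewrite /= inE; apply: (clique_subset _ KE); apply/fintype.subsetP => v.
  by rewrite inE => /asboolP xv; apply/negPn/negP => /xK.
by move=> v; split; rewrite inE => /asboolP // /contrapT.
Qed.

(** The coordinates of a point of the complex, as points of the plane. *)
Definition xval (x : X) (v : V) : C := \val ((\val x : torus R V) v).

Lemma continuous_xval v : continuous (fun x : X => xval x v).
Proof.
move=> x.
apply: (@continuous_comp _ _ _ (fun x : X => (\val x : torus R V) v) \val).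
  apply: (@continuous_comp X (torus R V) _ \val (fun y : torus R V => y v)).
    exact: continuous_val.
  exact: continuous_coord.
exact: continuous_val.
Qed.

Lemma cvg_X (T : Type) (Fi : set_system T) (f : T -> X) (a : X) : Filter Fi ->
  (forall v, xval (f x) v @[x --> Fi] --> xval a v) -> f @ Fi --> a.
Proof.
by move=> FF fa; apply: cvg_subtype; apply: cvg_prod => v; apply: cvg_subtype;
  exact: fa.
Qed.

Lemma xval_circle x v : on_circle (xval x v).
Proof.
rewrite /xval; case: (_ v) => p /= /set_mem.
by rewrite /circle /on_circle /dot /= -!expr2.
Qed.

Lemma X_ext (x y : X) : (forall v, xval x v = xval y v) -> x = y.
Proof.
by move=> xy; apply: val_inj; apply/funext => v; apply: val_inj; exact: xy.
Qed.

Lemma xval_clique (x : X) : exists2 K : {set V}, is_clique E K &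
  forall v, v \notin K -> xval x v = (1, 0).
Proof.
case: x => x xX; have /X_graphP[K KE xK] := set_mem xX; exists K => // v vK.
by rewrite /xval /= xK.
Qed.

Lemma circle_in (z : C) : on_circle z -> z \in @circle R.
Proof. by move=> hz; apply/mem_set; rewrite /circle /= -hz /dot !expr2. Qed.

Lemma X_build (f : V -> C) (K : {set V}) : is_clique E K ->
  (forall v, on_circle (f v)) -> (forall v, v \notin K -> f v = (1, 0)) ->
  exists x : X, forall v, xval x v = f v.
Proof.
move=> KE fc fK; pose x : torus R V :=
  fun v => exist _ (f v) (circle_in (fc v)).
have xX : x \in X.
  by apply/mem_set/X_graphP; exists K => // v vK; apply: val_inj; exact: fK.
by exists (exist _ x xX).
Qed.

End GraphPoints.

Section Lower.
Variables (R : realType) (V : finType) (E : {set {set V}}).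
Local Notation X := (X_graph R E).
Local Notation C := (R * R)%type.

Lemma continuous_expi : continuous (@expi R).
Proof.
have c : continuous (fun x : R => x * (pi *+ 2)).
  by move=> x; apply: cvgM; [exact: cvg_id|exact: cvg_cst].
move=> x; apply: cvg_to_pair.
  exact: (@continuous_comp _ _ _ _ cos x (c x) (@continuous_cos R _)).
exact: (@continuous_comp _ _ _ _ sin x (c x) (@continuous_sin R _)).
Qed.

(** Here [q] stands for a map from the torus to [X * X] in which the [i]-th
    circle coordinate occurs at the vertex [v] of one factor, while the other
    factor is at the base point there. The planned path at [v], reversed if the
    coordinate sits in the second factor, joins it to the base point. *)
Lemma planner_label m (F : set (X * X)) (s : F -> path_space R X)
    (q : 'rV[R]_m.+1 -> X * X) (i : 'I_m.+1) (v : V) (b : bool) :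
  continuous s -> (forall p : F, endpoints (s p) = \val p) ->
  continuous q ->
  (forall x z, q (x + lattice_pt R z) = q x) ->
  (forall x, xval (if b then (q x).1 else (q x).2) v = expi (x ord0 i)) ->
  (forall x, xval (if b then (q x).2 else (q x).1) v = (1, 0)) ->
  exists g : 'rV[R]_m.+1 -> int,
    (forall x z, F (q x) -> g (x + lattice_pt R z) = g x + z i) /\
    (forall x, F (q x) -> exists2 r, 0 < r &
       forall y, close r x y -> F (q y) -> g y = g x).
Proof.
move=> sc sE qc q_per qv qw.
pose H (p : F * @unit_interval R) : C := xval (path_fun (s p.1) p.2) v.
have Hc : continuous H.
  move=> p; apply: (@continuous_comp _ _ _ (fun p => path_fun (s p.1) p.2)
    (fun x : X => xval x v)); first exact: continuous_path_eval.
  exact: continuous_xval.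
pose rv (t : R) := if b then t else 1 - t.
have rvc : continuous rv.
  rewrite /rv; case: (b) => t; first exact: cvg_id.
  by apply: cvgB; [exact: cvg_cst|exact: cvg_id].
pose gam x t : C := if pselect (q x \in F) is left h then
  H (exist _ (q x) h, clampI (rv t)) else (1, 0).
have gamE x (h : q x \in F) t : gam x t = H (exist _ (q x) h, clampI (rv t)).
  by rewrite /gam; case: pselect => // h'; rewrite (bool_irrelevance h' h).
have Hcirc p : on_circle (H p) by exact: xval_circle.
apply: (@contraction_label R m (q @^-1` F) i gam).
- by move=> x z; rewrite /= q_per.
- by move=> x z _; rewrite /gam q_per.
- move=> x /mem_set xF.
  rewrite (_ : gam x = fun t => H (exist _ (q x) xF, clampI (rv t))).
    move=> t; apply: (@continuous_comp _ _ _
      (fun t => (exist _ (q x) xF : F, clampI (rv t))) H); last exact: Hc.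
    apply: cvg_to_pair; first exact: cvg_cst.
    exact: (@continuous_comp _ _ _ rv (@clampI R) t
      (rvc t) (@continuous_clampI R _)).
  by apply/funext => t; exact: gamE.
- by move=> x /mem_set xF t; rewrite gamE.
- move=> x /mem_set xF; rewrite gamE -qv; congr (xval _ v) => /=.
  have e0 := congr1 fst (sE (exist _ (q x) xF)).
  have e1 := congr1 snd (sE (exist _ (q x) xF)).
  by rewrite /rv; case: (b); rewrite ?subr0 ?clampI0 ?clampI1;
    [exact: e0|exact: e1].
- move=> x /mem_set xF; rewrite gamE -(qw x); congr (xval _ v) => /=.
  have e0 := congr1 fst (sE (exist _ (q x) xF)).
  have e1 := congr1 snd (sE (exist _ (q x) xF)).
  by rewrite /rv; case: (b); rewrite ?subrr ?clampI0 ?clampI1;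
    [exact: e1|exact: e0].
move=> x /mem_set xF; set p0 : F := exist _ (q x) xF.
have [W [oW Wx WP]] : exists W : set (X * X), [/\ open W, W (q x) &
    forall p : F, W (\val p) -> forall t, 0 < dot (H (p0, t)) (H (p, t))].
  have /compact_near_coveringP/(_ F (nbhs p0)
    (fun p t => 0 < dot (H (p0, t)) (H (p, t)))) cov := @interval_compact R.
  have [_ [[W oW <-] /= Wp0 WU]] : \forall p \near p0, setT `<=`
      (fun t => 0 < dot (H (p0, t)) (H (p, t))).
    apply: cov => t0 _.
    have : dot (H (p0, p.1)) (H (p.2, p.1)) @[p --> (t0, p0)] -->
        dot (H (p0, t0)) (H (p0, t0)).
      apply: cvg_dot.
        apply: (cvg_comp (fun p : @unit_interval R * F => (p0, p.1)) H);
          last exact: Hc.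
        by apply: cvg_to_pair; [exact: cvg_cst|exact: cvg_fst].
      apply: (cvg_comp (fun p : @unit_interval R * F => (p.2, p.1)) H);
        last exact: Hc.
      by apply: cvg_to_pair; [exact: cvg_snd|exact: cvg_fst].
    by move/cvgr_gt; apply; rewrite Hcirc.
  by exists W; split => // p Wp t; exact: (WU p Wp t).
have /nbhs_ballP[r /= r0 rW] : nbhs x (q @^-1` W).
  by apply: qc; exact: open_nbhs_nbhs.
exists r => // y xy /mem_set yF t _; rewrite (gamE _ xF) (gamE _ yF).
apply: (WP (exist _ (q y) yF)); apply: rW; split => // i0 j; rewrite ord1.
exact: xy.
Qed.

End Lower.

(** * The lower bound *)

Section LowerBound.
Variables (R : realType) (V : finType) (E : {set {set V}}).
Local Notation X := (X_graph R E).
Local Notation C := (R * R)%type.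

Lemma torus_in_graph (K : {set V}) (n : nat) (idx : V -> 'I_n) :
  is_clique E K ->
  exists a : 'rV[R]_n -> X, [/\ continuous a,
    forall x v, v \in K -> xval (a x) v = expi (x ord0 (idx v)) &
    forall x v, v \notin K -> xval (a x) v = (1, 0)].
Proof.
move=> KE; pose f (x : 'rV[R]_n) v : C :=
  if v \in K then expi (x ord0 (idx v)) else (1, 0).
have /choice[a aP] : forall x, exists a : X, forall v, xval a v = f x v.
  move=> x; apply: (X_build KE) => v; rewrite /f.
    by case: ifP => _; [exact: expi_circle|exact: base_circle].
  by move/negPf => ->.
exists a; split.
- move=> x; apply: (@cvg_X _ _ _ _ (nbhs x)) => v; rewrite aP.
  under eq_cvg do rewrite aP.
  rewrite /f; case: ifP => _; last exact: cvg_cst.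
  apply: (@continuous_comp _ _ _ (fun x : 'rV[R]_n =>
    x ord0 (idx v)) (@expi R)).
    exact: coord_continuous.
  exact: continuous_expi.
- by move=> x v vK; rewrite aP /f vK.
- by move=> x v /negPf vK; rewrite aP /f vK.
Qed.

(** The [i]-th piece is used with the [i]-th vertex of the union; [K2] is
    replaced by [K2 :\: K1] so that each vertex occurs in one factor only. *)
Lemma clique_pair_lt_planner (K1 K2 : {set V}) k :
  is_clique E K1 -> is_clique E K2 -> has_motion_planner R X k ->
  (#|K1 :|: K2|%SET < k)%N.
Proof.
move=> K1E K2E [F [_ F_cover _ [s sP]]].
have [x0 _] : exists x : X, forall v, xval x v = (1, 0).
  apply: (X_build K1E (f := fun=> (1, 0))) => // _; exact: base_circle.
rewrite ltnNge; apply/negP => k_le.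
have k_gt0 : (0 < k)%N.
  have : (\bigcup_i F i) (x0, x0) by rewrite F_cover.
  by case=> -[i ik] _ _; exact: leq_ltn_trans ik.
set W := (K1 :|: K2)%SET in k_le.
have [v0 v0W] : exists v0, v0 \in W by apply/card_gt0P; exact: leq_trans k_le.
have [m Wm] : exists m, #|W| = m.+1
  by case: #|W| (leq_trans k_gt0 k_le) => // m _; exists m.
pose vtx (i : 'I_m.+1) := nth v0 (enum W) i.
pose idx v : 'I_m.+1 := inord (index v (enum W)).
have szW : size (enum W) = m.+1 by rewrite -cardE.
have vtxK : cancel vtx idx.
  move=> i; apply: val_inj; rewrite /= /idx /vtx index_uniq ?enum_uniq ?szW //.
  by rewrite inordK.
have vtxW i : vtx i \in W by rewrite -mem_enum mem_nth // szW.
have K2'E : is_clique E (K2 :\: K1)%SET by apply: clique_subset K2E;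
  exact: subsetDl.
have [a [ac aK aN]] := torus_in_graph idx K1E.
have [b [bc bK bN]] := torus_in_graph idx K2'E.
pose q x := (a x, b x).
have qc : continuous q.
  by move=> x; exact: (@cvg_to_pair _ _ _ (nbhs x) q (q x) _ (ac x) (bc x)).
have q_per x z : q (x + lattice_pt R z) = q x.
  congr (_, _); apply: X_ext => v.
    have [vK|vK] := boolP (v \in K1); last by rewrite !aN.
    by rewrite !aK // !mxE expiDint.
  have [vK|vK] := boolP (v \in (K2 :\: K1)%SET); last by rewrite !bN.
  by rewrite !bK // !mxE expiDint.
pose A (i : 'I_m.+1) x := exists2 j : 'I_k, j = i :> nat & F j (q x).
have label i : exists g : 'rV[R]_m.+1 -> int,
    (forall x z, A i x -> g (x + lattice_pt R z) = g x + z i) /\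
    (forall x, A i x -> exists2 r, 0 < r &
       forall y, close r x y -> A i y -> g y = g x).
  have [ik|ki] := ltnP i k; last first.
    have nA x : ~ A i x by case=> j ji _; have := ltn_ord j; lia.
    by exists (fun=> 0); split=> x; [move=> z|] => /nA.
  have [sc sE] := sP (Ordinal ik).
  have AE x : A i x <-> F (Ordinal ik) (q x).
    split=> [[j ji]|]; last by exists (Ordinal ik).
    by rewrite (_ : j = Ordinal ik) //; exact: val_inj.
  have [||g [g1 g2]] := @planner_label R V E m _ _ q i (vtx i) (vtx i \in K1)
    sc sE qc q_per.
  - move=> x; have := vtxW i; rewrite finset.in_setU; case: ifP => vK.
      by rewrite aK // vtxK.
    by move=> /= vK2; rewrite bK ?vtxK // finset.in_setD vK vK2.
  - move=> x; case: ifP => vK; last by rewrite aN ?vK.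
    by rewrite bN // finset.in_setD vK.
  exists g; split=> [x z /AE|x /AE Ax]; first exact: g1.
  by have [r r0 rP] := g2 x Ax; exists r => // y xy /AE; exact: rP.
have /choice[g gP] := label.
apply: (@torus_cover R m A g).
- move=> x; have : (\bigcup_i F i) (q x) by rewrite F_cover.
  case=> j _ Fj; have jm : (j < m.+1)%N by rewrite -Wm; exact: leq_trans k_le.
  by exists (Ordinal jm), j.
- by move=> i x z [j ji Fj]; exists j => //; rewrite q_per.
- by move=> i x z; exact: (gP i).1.
- by move=> i x; exact: (gP i).2.
Qed.

Theorem planner_lower_bound k :
  has_motion_planner R X k -> (z_graph E + 1 <= k)%N.
Proof.
move=> planner; have clique0 : is_clique E finset.set0.
  by apply/'forall_implyP => x; rewrite inE.
have k_gt0 : (0 < k)%N.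
  exact: leq_ltn_trans (clique_pair_lt_planner clique0 clique0 planner).
rewrite addn1 -(prednK k_gt0) ltnS;
  apply/bigmax_leqP => -[K1 K2] /= /andP[K1E K2E].
by rewrite -ltnS prednK //; exact: clique_pair_lt_planner.
Qed.

End LowerBound.

(** * Normalization and shrinking in the plane *)

Section Plane.
Variable R : realType.
Local Notation C := (R * R)%type.
Local Notation base := (@base R).
Implicit Types (z w : C) (k d : R).

Definition normalize z : C := (z.1 / Num.sqrt (dot z z),
  z.2 / Num.sqrt (dot z z)).

Lemma dot_ge0 z : 0 <= dot z z.
Proof. by rewrite /dot -!expr2 addr_ge0 ?sqr_ge0. Qed.

Lemma normalize_circle z : 0 < dot z z -> on_circle (normalize z).
Proof.
move=> z0; rewrite /on_circle {1}/dot /normalize /=.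
set r := Num.sqrt _; have r2 : r ^+ 2 = dot z z by rewrite sqr_sqrtr // ltW.
have r0 : r != 0 by rewrite gt_eqF // sqrtr_gt0.
transitivity (dot z z / r ^+ 2); first by rewrite /dot; field.
by rewrite r2 divff // gt_eqF.
Qed.

Lemma normalize_id z : on_circle z -> normalize z = z.
Proof. by rewrite /normalize => ->; rewrite sqrtr1 !divr1; case: z. Qed.

Lemma normalize_le1 z : `|(normalize z).1| <= 1.
Proof.
rewrite /normalize /= normrM normfV [`|Num.sqrt _|]ger0_norm ?sqrtr_ge0 //.
have [->|d0] := eqVneq (dot z z) 0; first by rewrite sqrtr0 invr0 mulr0.
have dpos : 0 < dot z z by rewrite lt_def d0 dot_ge0.
rewrite ler_pdivrMr ?sqrtr_gt0 // mul1r -sqrtr_sqr ler_sqrt ?dot_ge0 //.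
by rewrite /dot -!expr2 lerDl sqr_ge0.
Qed.

Lemma normalize_real x : x != 0 -> normalize (x, 0) = (Num.sg x, 0).
Proof.
move=> x0; rewrite /normalize /dot /= mulr0 addr0 mul0r -expr2 sqrtr_sqr.
by congr (_, _); rewrite {1}(numEsg x) mulfK // normr_eq0.
Qed.

Definition mix z w k : C := (z.1 + k * (w.1 - z.1), z.2 + k * (w.2 - z.2)).

Lemma mix0 z w : mix z w 0 = z.
Proof. by rewrite /mix !mul0r !addr0; case: z. Qed.

Lemma mix1 z w : mix z w 1 = w.
Proof. by rewrite /mix !mul1r !subrKC; case: w. Qed.

Lemma mixzz z k : mix z z k = z.
Proof. by rewrite /mix !subrr !mulr0 !addr0; case: z. Qed.

Lemma dot_geN1 z w : on_circle z -> on_circle w -> -1 <= dot z w.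
Proof.
move=> hz hw; have := dot_cross hz hw; have := sqr_ge0 (cross z w); nra.
Qed.

Lemma dotN1 z w : on_circle z -> on_circle w -> dot z w = -1 ->
  w = (- z.1, - z.2).
Proof.
case: z w => [a b] [c d]; rewrite /on_circle /dot /= => hz hw zw.
have : (a + c) ^+ 2 + (b + d) ^+ 2 = 0.
  transitivity ((a * a + b * b) + (c * c + d * d) + 2 * (a * c + b * d));
    first by ring.
  by rewrite hz hw zw; ring.
move/eqP; rewrite paddr_eq0 ?sqr_ge0 // !sqrf_eq0 => /andP[/eqP ac /eqP bd].
by congr (_, _); lra.
Qed.

Lemma mix_neq0 z w k : on_circle z -> on_circle w -> 0 <= k <= 1 ->
  -1 < dot z w -> 0 < dot (mix z w k) (mix z w k).
Proof.
move=> hz hw /andP[k0 k1] zw.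
have -> : dot (mix z w k) (mix z w k) =
    (1 - k) ^+ 2 * dot z z + k ^+ 2 * dot w w + 2 * k * (1 - k) * dot z w.
  by rewrite /dot /mix /=; ring.
rewrite hz hw; set d := dot z w in zw *; set p := k * (1 - k).
have p0 : 0 <= p by rewrite mulr_ge0 // subr_ge0.
have p4 : 4 * p <= 1 by rewrite /p; have := sqr_ge0 (1 - 2 * k); nra.
rewrite [ltRHS](_ : _ = 1 - 4 * p + 2 * p * (1 + d)); last by rewrite /p; ring.
have [->|pN0] := eqVneq p 0; first by lra.
have : 0 < p by rewrite lt_def pN0.
nra.
Qed.

(** On the circle this is half of the squared distance to [base]. *)
Definition dev z : R := 1 - z.1.

Lemma dev_ge0 z : on_circle z -> 0 <= dev z.
Proof. by rewrite /on_circle /dot /dev => hz; have := sqr_ge0 z.2; nra. Qed.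

Lemma dev_eq0 z : on_circle z -> dev z = 0 -> z = base.
Proof.
case: z => a b; rewrite /on_circle /dot /dev /= => hz /eqP;
  rewrite subr_eq0 => /eqP a1.
congr (_, _); first by [].
by apply/eqP; rewrite -sqrf_eq0; apply/eqP; move: hz; rewrite -a1; lra.
Qed.

(** The ratio vanishes when [0 < dev z <= d], and is 1 when [d = 0]; so
    [shrink d] collapses the arc [dev z <= d] around [base] and stretches the
    rest of the circle. At [z = base] the ratio has the
    conventional value 1. *)
Definition shrink_ratio d z : R := Num.max 0 (1 - d / dev z).
Definition shrink d z : C := normalize (mix base z (shrink_ratio d z)).

Lemma shrink_ratio01 d z : 0 <= d -> z.1 <= 1 -> 0 <= shrink_ratio d z <= 1.
Proof.
move=> d0 z1; rewrite le_max lexx ge_max ler01 /= gerBl divr_ge0 //.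
by rewrite subr_ge0.
Qed.

Lemma circle_le1 z : on_circle z -> z.1 <= 1.
Proof. by move/dev_ge0; rewrite subr_ge0. Qed.

Lemma shrink_small d z : on_circle z -> dev z <= d -> shrink d z = base.
Proof.
move=> hz zd; have [e0|e0] := eqVneq (dev z) 0.
  by rewrite /shrink (dev_eq0 hz e0) mixzz normalize_id //; exact: base_circle.
have dev0 : 0 < dev z by rewrite lt_def e0 dev_ge0.
rewrite /shrink /shrink_ratio max_l.
  by rewrite mix0 normalize_id //; exact: base_circle.
by rewrite subr_le0 ler_pdivlMr // mul1r.
Qed.

Lemma shrink0 z : on_circle z -> shrink 0 z = z.
Proof.
move=> hz; rewrite /shrink /shrink_ratio mul0r subr0 max_r ?ler01 // mix1.
exact: normalize_id.
Qed.

(** The segment from [base] to its antipode is cut beyond its midpoint, which is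
    where [d < 1] matters. *)
Lemma shrink_antipode d : 0 <= d < 1 -> shrink d (-1, 0) = (-1, 0).
Proof.
move=> d01; rewrite /shrink /shrink_ratio /dev /= (_ : 1 - -1 = 2);
  last by ring.
rewrite max_r; last by lra.
rewrite /mix /= [X in (_, X)](_ : _ = 0); last by ring.
rewrite normalize_real; last by apply/eqP; lra.
by rewrite ltr0_sg //; lra.
Qed.

Lemma shrink_mix_neq0 d z : on_circle z -> 0 <= d < 1 ->
  0 < dot (mix base z (shrink_ratio d z)) (mix base z (shrink_ratio d z)).
Proof.
move=> hz d01; have [e|e] := eqVneq (dot base z) (-1).
  have := dotN1 (base_circle R) hz e; rewrite /= oppr0 => ->.
  rewrite /shrink_ratio /dev /= (_ : 1 - -1 = 2); last by ring.
  rewrite max_r; last by lra.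
  rewrite /mix /dot /=; nra.
apply: mix_neq0 => //; first exact: base_circle.
  apply: shrink_ratio01; last exact: circle_le1.
  by case/andP: d01.
by rewrite lt_def e dot_geN1 //; exact: base_circle.
Qed.

Lemma shrink_circle d z : on_circle z -> 0 <= d < 1 -> on_circle (shrink d z).
Proof. by move=> hz d01; apply: normalize_circle; exact: shrink_mix_neq0. Qed.

End Plane.

Section PlaneCvg.
Variables (R : realType) (T : Type) (Fi : set_system T).
Context {FF : Filter Fi}.
Local Notation C := (R * R)%type.
Implicit Types (f g : T -> C) (z w : C) (k : T -> R).

Lemma cvg_normalize f z : f @ Fi --> z -> 0 < dot z z ->
  normalize (f x) @[x --> Fi] --> normalize z.
Proof.
move=> fz z0.
have rz : (Num.sqrt (dot (f x) (f x)))^-1 @[x --> Fi] -->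
  (Num.sqrt (dot z z))^-1.
  apply: cvgV; first by rewrite gt_eqF // sqrtr_gt0.
  apply: (cvg_comp _ _ (cvg_dot fz fz)); exact: sqrt_continuous.
by apply: cvg_to_pair; apply: cvgM => //;
  [exact: cvg_pair1 fz|exact: cvg_pair2 fz].
Qed.

Lemma cvg_mix f g k z w l : f @ Fi --> z -> g @ Fi --> w -> k @ Fi --> l ->
  mix (f x) (g x) (k x) @[x --> Fi] --> mix z w l.
Proof.
move=> fz gw kl; apply: cvg_to_pair => /=.
  apply: cvgD; first exact: cvg_pair1 fz.
  by apply: cvgM => //; apply: cvgB; [exact: cvg_pair1 gw|exact: cvg_pair1 fz].
apply: cvgD; first exact: cvg_pair2 fz.
by apply: cvgM => //; apply: cvgB; [exact: cvg_pair2 gw|exact: cvg_pair2 fz].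
Qed.

Lemma cvg_bounded_mul0 (k h : T -> R) : (forall x, 0 <= k x <= 1) ->
  h @ Fi --> 0 -> k x * h x @[x --> Fi] --> 0.
Proof.
move=> k01 h0; apply: norm_cvg0.
apply: (@squeeze_cvgr _ _ _ _ (fun=> 0) (fun x => `|h x|)).
- apply: nearW => x; rewrite normr_ge0 normrM; have /andP[k0 k1] := k01 x.
  by rewrite ger0_norm // ler_piMl.
- exact: cvg_cst.
- by rewrite -(@normr0 _ R); exact: cvg_norm.
Qed.

(** When the end points have the same limit, the position on the segment is
    irrelevant; this covers the points at which the ratios used below are
    discontinuous. *)
Lemma cvg_mix_merge f g k z : f @ Fi --> z -> g @ Fi --> z ->
  (forall x, 0 <= k x <= 1) -> mix (f x) (g x) (k x) @[x --> Fi] --> z.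
Proof.
move=> fz gz k01; apply: cvg_to_pair => /=.
  rewrite -[X in _ --> X]addr0; apply: cvgD; first exact: cvg_pair1 fz.
  apply: cvg_bounded_mul0 => //; rewrite -[X in _ --> X](subrr z.1).
  by apply: cvgB; [exact: cvg_pair1 gz|exact: cvg_pair1 fz].
rewrite -[X in _ --> X]addr0; apply: cvgD; first exact: cvg_pair2 fz.
apply: cvg_bounded_mul0 => //; rewrite -[X in _ --> X](subrr z.2).
by apply: cvgB; [exact: cvg_pair2 gz|exact: cvg_pair2 fz].
Qed.

Lemma cvg_shrink (d : T -> R) f d0 z : d @ Fi --> d0 -> f @ Fi --> z ->
  (forall x, 0 <= d x) -> (forall x, (f x).1 <= 1) ->
  0 <= d0 < 1 -> on_circle z -> shrink (d x) (f x) @[x --> Fi] --> shrink d0 z.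
Proof.
move=> dd fz d_ge0 f1 d01 hz; apply: cvg_normalize; last exact: shrink_mix_neq0.
have [e0|e0] := eqVneq (dev z) 0.
  rewrite [X in mix _ X _](dev_eq0 hz e0) mixzz; apply: cvg_mix_merge.
  - exact: cvg_cst.
  - by rewrite -(dev_eq0 hz e0).
  - by move=> x; exact: shrink_ratio01.
apply: cvg_mix => //; first exact: cvg_cst.
apply: cvg_max; first exact: cvg_cst.
apply: cvgB; first exact: cvg_cst.
apply: cvgM => //; apply: cvgV => //; apply: cvgB; first exact: cvg_cst.
exact: cvg_pair1 fz.
Qed.

End PlaneCvg.

(** * A neighborhood retraction onto a stratum *)

Lemma cvg_rV (R : realType) (T : Type) (Fi : set_system T) n
  (f : T -> 'rV[R]_n) (a : 'rV[R]_n) : Filter Fi ->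
  (forall j, f x ord0 j @[x --> Fi] --> a ord0 j) -> f @ Fi --> a.
Proof.
move=> FF fa; apply/cvg_ballP => e e0.
have : \forall x \near Fi, forall j, ball (a ord0 j) e (f x ord0 j).
  by apply: filter_forall => j; exact: (cvg_ball (fa j)).
by apply: filterS => x xe; split=> // i j; rewrite ord1.
Qed.

(** If [g] is a left inverse of [f] on an open neighborhood, then [f \o g]
    retracts this neighborhood onto the image of [f]. *)
Lemma ENR_criterion (R : realType) (T : topologicalType) N (U : set 'rV[R]_N)
    (f : T -> 'rV[R]_N) (g : U -> T) :
  open U -> continuous f -> continuous g ->
  (forall p (h : f p \in U), g (exist _ (f p) h) = p) -> (forall p, U (f p)) ->
  is_ENR R T.
Proof.
move=> oU fc gc gf fU; pose Y := range f.
have inY p : f p \in Y by apply/mem_set; exists p.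
have YU : Y `<=` U by move=> _ [p _ <-].
pose incl (y : Y) : U := exist _ (\val y) (mem_set (YU _ (set_mem (valP y)))).
have incl_c : continuous incl by apply: continuous_subtype;
  exact: continuous_val.
pose fY p : Y := exist _ (f p) (inY p).
have fY_c : continuous fY by apply: continuous_subtype; exact: fc.
have fYg (y : Y) : fY (g (incl y)) = y.
  case: y => y yY; have [p _ fp] := set_mem yY; apply: val_inj => /=.
  rewrite /incl /=; move: (mem_set _); rewrite /= -fp => h.
  by rewrite gf.
exists N, Y, U; split=> //.
  exists fY, (g \o incl); split=> //.
    by move=> y; apply: continuous_comp; [exact: incl_c|exact: gc].
  by move=> p /=; exact: gf.
split=> //; exists (fY \o g); split.
  by move=> u; apply: continuous_comp; [exact: gc|exact: fY_c].
move=> u Yu; have := fYg (exist _ (\val u) (mem_set Yu)) => /(congr1 \val) /=.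
by rewrite (_ : incl _ = u) //; apply: val_inj.
Qed.

Section Retraction.
Variables (R : realType) (V : finType) (E : {set {set V}}).
Local Notation X := (X_graph R E).
Local Notation C := (R * R)%type.
Implicit Types (x y : V -> C) (S : {set V}).

(** The distance, in terms of [dev], to the configurations whose support is
    contained in a clique. The value 2 bounds [dev] on
    the circle. *)
Definition defect x : R :=
  \big[Order.min/2]_(K : {set V} | is_clique E K)
    \big[Order.max/0]_(v | v \notin K) dev (x v).

Lemma defect_ge0 x : 0 <= defect x.
Proof. by apply/bigmin_geP; split=> // K _; exact: bigmax_ge_id. Qed.

Lemma defect_clique x : defect x < 1 ->
  exists2 K, is_clique E K & forall v, v \notin K -> dev (x v) <= defect x.
Proof.
move=> x1; have /bigmin_leP := lexx (defect x); case; first by lra.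
case=> K KE Kx; exists K => // v vK; apply: le_trans Kx.
exact: (le_bigmax_cond _ (fun v => dev (x v))).
Qed.

Lemma defect_eq0 x K :
  is_clique E K -> (forall v, v \notin K -> x v = base R) -> defect x = 0.
Proof.
move=> KE xK; apply/eqP; rewrite eq_le defect_ge0 andbT.
apply/bigmin_leP; right; exists K => //; apply: bigmax_le => // v /xK ->.
by rewrite /dev subrr.
Qed.

Lemma cvg_defect (T : Type) (Fi : set_system T) (f : T -> V -> C) x :
  Filter Fi -> (forall v, f t v @[t --> Fi] --> x v) ->
  defect (f t) @[t --> Fi] --> defect x.
Proof.
move=> FF fx; apply: cvg_big => [z|K _]; first exact: cvg_min cvg_fst cvg_snd.
apply: cvg_big => [z|v _]; first exact: cvg_max cvg_fst cvg_snd.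
by apply: cvgB; [exact: cvg_cst|exact: cvg_pair1 (fx v)].
Qed.

Definition oppC (z : C) : C := (- z.1, - z.2).

Lemma oppC_circle z : on_circle z -> on_circle (oppC z).
Proof. by rewrite /on_circle /dot /= !mulrNN. Qed.

Lemma oppC_base : oppC (base R) = (-1, 0).
Proof. by rewrite /oppC /= oppr0. Qed.

(** The retraction onto the pairs of points of the complex that are antipodal
    on [S] is done in four steps. First [x] is shrunk into the complex; then
    [y] is made antipodal to it on [S]; then [y] is shrunk into the complex;
    finally [x] is made antipodal to [y] on [S]. The last step cannot enlarge
    the support of [x]: at a vertex of [S] where [x] is at the base point, [y]
    is at the antipode of the base point, which [shrink] fixes. *)
Definition step_x1 x v : C := shrink (defect x) (x v).
Definition step_y1 S x y v : C := if v \in S then oppC (step_x1 x v) else y v.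
Definition step_y2 S x y v : C :=
  shrink (defect (step_y1 S x y)) (step_y1 S x y v).
Definition step_x2 S x y v : C :=
  if v \in S then oppC (step_y2 S x y v) else step_x1 x v.

(** The steps apply to [(x, y)] and lead to a pair whose antipodal set is
    exactly [S]. The last condition says that [S] collects the vertices that
    are closest to being antipodal; it makes [S] unique for its cardinality, so
    that the neighborhoods of the various [S] in a stratum are disjoint. *)
Definition retractable S x y : Prop :=
  [/\ defect x < 1, defect (step_y1 S x y) < 1,
      forall v, v \notin S -> -1 < dot (step_x2 S x y v) (step_y2 S x y v) &
      forall v w, v \in S -> w \notin S -> dot (x v) (y v) < dot (x w) (y w)].

Lemma retractable_unique S S' x y : #|S| = #|S'| ->
  retractable S x y -> retractable S' x y -> S = S'.
Proof.
move=> SS' [_ _ _ hS] [_ _ _ hS']; apply/eqP; rewrite eqEcard SS' leqnn andbT.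
apply/fintype.subsetP => v vS; apply/negPn/negP => vS'.
have [w wS' wS] : exists2 w, w \in S' & w \notin S.
  apply/subsetPn; apply/negP => S'S; have /eqP SE : S' == S
    by rewrite eqEcard S'S SS' /=.
  by rewrite SE vS in vS'.
by have := hS v w vS wS; have := hS' w v wS' vS'; lra.
Qed.

Section Result.
Variables (S : {set V}) (x y : V -> C).
Hypotheses (xc : forall v, on_circle (x v)) (yc : forall v, on_circle (y v)).
Hypothesis Snear : retractable S x y.

Let d1 : 0 <= defect x < 1. Proof. by rewrite defect_ge0; case: Snear. Qed.
Let d2 : 0 <= defect (step_y1 S x y) < 1.
Proof. by rewrite defect_ge0; case: Snear. Qed.

Lemma step_x1_circle v : on_circle (step_x1 x v).
Proof. exact: shrink_circle. Qed.

Lemma step_y1_circle v : on_circle (step_y1 S x y v).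
Proof. by rewrite /step_y1; case: ifP => // _;
  apply/oppC_circle/step_x1_circle. Qed.

Lemma step_y2_circle v : on_circle (step_y2 S x y v).
Proof. by apply: shrink_circle => //; exact: step_y1_circle. Qed.

Lemma step_x2_circle v : on_circle (step_x2 S x y v).
Proof.
rewrite /step_x2; case: ifP => _; last exact: step_x1_circle.
exact/oppC_circle/step_y2_circle.
Qed.

Lemma step_y2_clique : exists2 K, is_clique E K &
  forall v, v \notin K -> step_y2 S x y v = base R.
Proof.
have [K KE Ky] := @defect_clique (step_y1 S x y) ltac:(by case/andP: d2).
by exists K => // v /Ky vK; apply: shrink_small => //; exact: step_y1_circle.
Qed.

Lemma step_x2_clique : exists2 K, is_clique E K &
  forall v, v \notin K -> step_x2 S x y v = base R.
Proof.
have [K KE Kx] := @defect_clique x ltac:(by case/andP: d1).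
exists K => // v /Kx vK; have x1 : step_x1 x v = base R by exact: shrink_small.
rewrite /step_x2 /step_y2 /step_y1 x1; case: ifP => // vS.
by rewrite vS oppC_base shrink_antipode // /oppC /= opprK oppr0.
Qed.

Lemma step_antipodal v : (dot (step_x2 S x y v) (step_y2 S x y v) == -1) =
  (v \in S).
Proof.
have [vS|vS] := boolP (v \in S).
  apply/eqP; rewrite /step_x2 vS /dot /= !mulNr -opprD.
  by have := step_y2_circle v; rewrite /on_circle /dot => ->.
by apply/negbTE; rewrite gt_eqF //; case: Snear => _ _ + _; apply.
Qed.

End Result.

Lemma steps_fixed S x y :
  (forall v, on_circle (x v)) -> (forall v, on_circle (y v)) ->
  (exists2 K, is_clique E K & forall v, v \notin K -> x v = base R) ->
  (exists2 K, is_clique E K & forall v, v \notin K -> y v = base R) ->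
  (forall v, (dot (x v) (y v) == -1) = (v \in S)) ->
  [/\ retractable S x y, forall v, step_x2 S x y v = x v &
      forall v, step_y2 S x y v = y v].
Proof.
move=> xc yc [K KE xK] [L LE yL] xyS.
have dx : defect x = 0 by exact: defect_eq0 KE xK.
have x1 v : step_x1 x v = x v by rewrite /step_x1 dx shrink0.
have opp v : v \in S -> y v = oppC (x v).
  by rewrite -xyS => /eqP; exact: dotN1.
have y1 : step_y1 S x y = y.
  by apply/funext => v; rewrite /step_y1 x1; case: ifP => // /opp.
have dy : defect y = 0 by exact: defect_eq0 LE yL.
have y2 v : step_y2 S x y v = y v by rewrite /step_y2 y1 dy shrink0.
have x2 v : step_x2 S x y v = x v.
  rewrite /step_x2 y2 x1; case: ifP => // /opp ->.
  by rewrite /oppC /= !opprK; case: (x v).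
split=> //; split; rewrite ?y1 ?dx ?dy //.
  by move=> v vS; rewrite x2 y2 lt_def xyS vS dot_geN1.
move=> v w vS wS; move: (vS); rewrite -xyS => /eqP ->.
by rewrite lt_def xyS wS dot_geN1.
Qed.

Section StepCvg.
Variables (T : Type) (Fi : set_system T) (f g : T -> V -> C).
Context {FF : Filter Fi}.
Variables (S : {set V}) (x y : V -> C).
Hypotheses (xc : forall v, on_circle (x v)) (yc : forall v, on_circle (y v)).
Hypothesis fx : forall v, f t v @[t --> Fi] --> x v.
Hypothesis gy : forall v, g t v @[t --> Fi] --> y v.
Hypothesis f1 : forall t v, `|(f t v).1| <= 1.
Hypothesis g1 : forall t v, `|(g t v).1| <= 1.
Hypothesis Snear : retractable S x y.

Let d1 : 0 <= defect x < 1. Proof. by rewrite defect_ge0; case: Snear. Qed.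
Let d2 : 0 <= defect (step_y1 S x y) < 1.
Proof. by rewrite defect_ge0; case: Snear. Qed.

Lemma cvg_oppC (h : T -> C) z : h @ Fi --> z -> oppC (h t) @[t --> Fi] -->
  oppC z.
Proof.
move=> hz; apply: cvg_to_pair => /=.
  by apply: cvgN; exact: cvg_pair1 hz.
by apply: cvgN; exact: cvg_pair2 hz.
Qed.

Lemma cvg_x1 v : step_x1 (f t) v @[t --> Fi] --> step_x1 x v.
Proof.
apply: cvg_shrink => //; first exact: cvg_defect.
  by move=> t; exact: defect_ge0.
by move=> t; have := f1 t v; rewrite ler_norml => /andP[].
Qed.

Lemma cvg_y1 v : step_y1 S (f t) (g t) v @[t --> Fi] --> step_y1 S x y v.
Proof. by rewrite /step_y1; case: ifP => _ //; apply: cvg_oppC;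
  exact: cvg_x1. Qed.

Lemma cvg_y2 v : step_y2 S (f t) (g t) v @[t --> Fi] --> step_y2 S x y v.
Proof.
apply: cvg_shrink => //; last exact: step_y1_circle.
- by apply: cvg_defect => w; exact: cvg_y1.
- exact: cvg_y1.
- by move=> t; exact: defect_ge0.
move=> t; rewrite /step_y1; case: ifP => _; last first.
  by have := g1 t v; rewrite ler_norml => /andP[].
have := normalize_le1 (mix (base R) (f t v)
  (shrink_ratio (defect (f t)) (f t v))).
by rewrite ler_norml /= lerNl => /andP[].
Qed.

Lemma cvg_x2 v : step_x2 S (f t) (g t) v @[t --> Fi] --> step_x2 S x y v.
Proof.
rewrite /step_x2; case: ifP => _; last exact: cvg_x1.
by apply: cvg_oppC; exact: cvg_y2.
Qed.

(** Strict inequalities between continuous functions. *)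
Lemma near_retractable : \forall t \near Fi, retractable S (f t) (g t).
Proof.
case: Snear => x_lt y_lt anti sep.
have n1 : \forall t \near Fi, defect (f t) < 1.
  by exact: (cvgr_lt _ (cvg_defect FF fx) _ x_lt).
have n2 : \forall t \near Fi, defect (step_y1 S (f t) (g t)) < 1.
  by exact: (cvgr_lt _ (cvg_defect FF cvg_y1) _ y_lt).
have n3 : \forall t \near Fi, forall v, v \notin S ->
    -1 < dot (step_x2 S (f t) (g t) v) (step_y2 S (f t) (g t) v).
  apply: filter_forall => v; have [vS|vS] := boolP (v \in S);
    first exact: nearW.
  by apply: filterS (cvgr_gt _ (cvg_dot (@cvg_x2 v) (@cvg_y2 v)) _ (anti v vS)).
have n4 : \forall t \near Fi, forall v w, v \in S -> w \notin S ->
    dot (f t v) (g t v) < dot (f t w) (g t w).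
  apply: filter_forall => v; apply: filter_forall => w.
  have [vS|vS] := boolP (v \in S); last exact: nearW.
  have [wS|wS] := boolP (w \in S); first exact: nearW.
  have dfg u : dot (f t u) (g t u) @[t --> Fi] --> dot (x u) (y u)
    by exact: cvg_dot.
  have sep0 : 0 < dot (x w) (y w) - dot (x v) (y v) by rewrite subr_gt0 sep.
  have near_sep : \forall t \near Fi,
    0 < dot (f t w) (g t w) - dot (f t v) (g t v).
    exact: (cvgr_gt _ (cvgB (dfg w) (dfg v)) _ sep0).
  by apply: filterS near_sep => t; rewrite subr_gt0.
by near=> t; split; near: t.
Unshelve. all: by end_near. Qed.

End StepCvg.

End Retraction.

(** * The strata are Euclidean neighborhood retracts *)

Section Pieces.
Variables (R : realType) (V : finType) (E : {set {set V}}).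
Local Notation X := (X_graph R E).
Local Notation C := (R * R)%type.

Definition antipodal_set (p : X * X) : {set V} :=
  [set v | dot (xval p.1 v) (xval p.2 v) == -1]%SET.

Definition piece (i : nat) : set (X * X) := [set p | #|antipodal_set p| = i].

Lemma cvg_piece (T : Type) (Fi : set_system T) i
    (f : T -> piece i) (p : piece i) :
  Filter Fi ->
  (forall v, xval (\val (f t)).1 v @[t --> Fi] --> xval (\val p).1 v) ->
  (forall v, xval (\val (f t)).2 v @[t --> Fi] --> xval (\val p).2 v) ->
  f @ Fi --> p.
Proof.
by move=> FF f1 f2; apply: cvg_subtype; apply: cvg_to_pair; apply: cvg_X.
Qed.

Lemma continuous_xval1 i v : continuous (fun p : piece i => xval (\val p).1 v).
Proof.
move=> p; apply: (@continuous_comp _ _ _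
  (fun p : piece i => (\val p).1) (fun x : X => xval x v)).
  apply: (@continuous_comp _ _ _ (fun p : piece i => \val p) fst).
    exact: continuous_val.
  exact: cvg_fst.
exact: continuous_xval.
Qed.

Lemma continuous_xval2 i v : continuous (fun p : piece i => xval (\val p).2 v).
Proof.
move=> p; apply: (@continuous_comp _ _ _
  (fun p : piece i => (\val p).2) (fun x : X => xval x v)).
  apply: (@continuous_comp _ _ _ (fun p : piece i => \val p) snd).
    exact: continuous_val.
  exact: cvg_snd.
exact: continuous_xval.
Qed.

Local Notation N := #|{: V * bool * bool}|.

Definition embed (p : X * X) : 'rV[R]_N := \row_j
  let: (v, b, c) := enum_val j in
  let z := xval (if b then p.1 else p.2) v in if c then z.1 else z.2.

(** The index [(v, b, c)] of [embed] stands for the vertex [v], the first or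
    second factor [b], and the component [c] of a point of the plane. *)
Definition decode (b : bool) (u : 'rV[R]_N) (v : V) : C :=
  (u ord0 (enum_rank (v, b, true)), u ord0 (enum_rank (v, b, false))).

Lemma decode_embed b p v : decode b (embed p) v =
  xval (if b then p.1 else p.2) v.
Proof. by rewrite /decode !mxE !enum_rankK; case: (xval _ v). Qed.

Lemma cvg_decode b u v : decode b u' v @[u' --> u] --> decode b u v.
Proof.
have c j : (u' ord0 j : R) @[u' --> u] --> (u ord0 j : R)
  by exact: coord_continuous.
by apply: (@cvg_to_pair _ _ _ (nbhs u)); [exact: c|exact: c].
Qed.

Definition unit_decode b u v : C := normalize (decode b u v).
Definition nonzero (u : 'rV[R]_N) :=
  forall b v, 0 < dot (decode b u v) (decode b u v).

Lemma cvg_unit_decode b u v : nonzero u -> unit_decode b u' v @[u' --> u] -->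
  unit_decode b u v.
Proof. by move=> u0; apply: (@cvg_normalize _ _ (nbhs u));
  [exact: cvg_decode|exact: u0]. Qed.

Lemma unit_decode_circle b u v : nonzero u -> on_circle (unit_decode b u v).
Proof. by move=> u0; exact: normalize_circle. Qed.

Lemma unit_decode_embed b p v : unit_decode b (embed p) v =
  xval (if b then p.1 else p.2) v.
Proof. by rewrite /unit_decode decode_embed normalize_id //;
  exact: xval_circle. Qed.

Lemma near_nonzero u : nonzero u -> \forall u' \near u, nonzero u'.
Proof.
move=> u0; have FF : Filter (nbhs u) by exact: nbhs_filter.
apply: (filter_forall (F := nbhs u)) => b.
apply: (filter_forall (F := nbhs u)) => v.
have dotc : dot (decode b u' v) (decode b u' v) @[u' --> u] -->
  dot (decode b u v) (decode b u v).
  by apply: (@cvg_dot _ _ (nbhs u)); exact: cvg_decode.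
exact: (cvgr_gt _ dotc _ (u0 b v)).
Qed.

Local Notation x0 := (unit_decode true).
Local Notation y0 := (unit_decode false).

Lemma near_retractable_decode S u : nonzero u ->
  retractable E S (x0 u) (y0 u) ->
  \forall u' \near u, retractable E S (x0 u') (y0 u').
Proof.
move=> u0 Snear.
apply: (@near_retractable R V E _ (nbhs u) _ _ _ S (x0 u) (y0 u)) => //.
- by move=> v; exact: unit_decode_circle.
- by move=> v; exact: unit_decode_circle.
- by move=> v; exact: cvg_unit_decode.
- by move=> v; exact: cvg_unit_decode.
- by move=> u' v; exact: normalize_le1.
- by move=> u' v; exact: normalize_le1.
Qed.

Definition piece_nbhd i : set 'rV[R]_N :=
  [set u | nonzero u /\
    exists2 S : {set V}, #|S| = i & retractable E S (x0 u) (y0 u)].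

Lemma piece_nbhd_open i : open (piece_nbhd i).
Proof.
rewrite openE => u [u0 [S Si Snear]]; rewrite /interior.
near=> u'; split; first by near: u'; exact: near_nonzero.
exists S => //; near: u'; exact: near_retractable_decode.
Unshelve. all: by end_near. Qed.

(** The result is stated for all [S], so that its continuity can be read off
    with an [S] that is fixed in a neighborhood. *)
Lemma piece_retract_exists i (u : piece_nbhd i) : exists p : piece i,
  forall S : {set V}, #|S| = i ->
    retractable E S (x0 (\val u)) (y0 (\val u)) -> forall v,
    xval (\val p).1 v = step_x2 E S (x0 (\val u)) (y0 (\val u)) v /\
    xval (\val p).2 v = step_y2 E S (x0 (\val u)) (y0 (\val u)) v.
Proof.
case: u => u uU; case: (set_mem uU) => u0 [S Si Snear] /=.
have xc v : on_circle (x0 u v) by exact: unit_decode_circle.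
have yc v : on_circle (y0 u v) by exact: unit_decode_circle.
have [K KE xK] := step_x2_clique xc Snear.
have [L LE yL] := step_y2_clique xc yc Snear.
have [x xE] := X_build KE (step_x2_circle xc yc Snear) xK.
have [y yE] := X_build LE (step_y2_circle xc yc Snear) yL.
have xyi : (x, y) \in piece i.
  apply/mem_set; rewrite /piece /= -Si; congr #|pred_of_set _|; apply/setP => v.
  by rewrite inE /= xE yE step_antipodal.
exists (exist _ (x, y) xyi) => S' S'i S'near v /=.
by rewrite -(retractable_unique _ Snear S'near) ?Si ?S'i.
Qed.

Lemma piece_ENR i : is_ENR R (piece i).
Proof.
have /choice[g gP] := @piece_retract_exists i.
have embedP (p : piece i) : retractable E (antipodal_set (\val p))
    (x0 (embed (\val p))) (y0 (embed (\val p))) /\ forall v,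
    step_x2 E (antipodal_set (\val p))
        (x0 (embed (\val p))) (y0 (embed (\val p))) v = xval (\val p).1 v /\
    step_y2 E (antipodal_set (\val p))
        (x0 (embed (\val p))) (y0 (embed (\val p))) v = xval (\val p).2 v.
  have -> : x0 (embed (\val p)) = xval (\val p).1.
    by apply/funext => v; rewrite unit_decode_embed.
  have -> : y0 (embed (\val p)) = xval (\val p).2.
    by apply/funext => v; rewrite unit_decode_embed.
  have [//|//|//|//|v|] := @steps_fixed R V E (antipodal_set (\val p))
    (xval (\val p).1) (xval (\val p).2); first 4 last.
  - by rewrite inE.
  - by move=> Snear x2 y2; split=> // v; split.
  - by move=> v; exact: xval_circle.
  - by move=> v; exact: xval_circle.
  - exact: xval_clique.
  - exact: xval_clique.
apply: (@ENR_criterion R _ N (piece_nbhd i)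
  (fun p : piece i => embed (\val p)) g).
- exact: piece_nbhd_open.
- move=> p; apply: (@cvg_rV _ _ (nbhs p)) => j; rewrite !mxE.
  under eq_cvg do rewrite !mxE.
  case: (enum_val j) => -[v b] c.
  case: b; case: c.
  + by apply: cvg_pair1; exact: continuous_xval1.
  + by apply: cvg_pair2; exact: continuous_xval1.
  + by apply: cvg_pair1; exact: continuous_xval2.
  + by apply: cvg_pair2; exact: continuous_xval2.
- move=> u; have [u0 [S Si Snear]] := set_mem (valP u).
  have FF : Filter (nbhs u) by exact: nbhs_filter.
  have val_u : \val u' @[u' --> u] --> \val u by exact: continuous_val.
  have goodN : \forall u' \near u,
    retractable E S (x0 (\val u')) (y0 (\val u')).
    exact: (val_u _ (near_retractable_decode u0 Snear)).
  have gN v : \forall u' \near u,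
      xval (\val (g u')).1 v = step_x2 E S (x0 (\val u')) (y0 (\val u')) v /\
      xval (\val (g u')).2 v = step_y2 E S (x0 (\val u')) (y0 (\val u')) v.
    by apply: filterS goodN => u' Snear'; exact: (gP u' S Si Snear' v).
  have xc v : on_circle (x0 (\val u) v) by exact: unit_decode_circle.
  have yc v : on_circle (y0 (\val u) v) by exact: unit_decode_circle.
  have fx v : x0 (\val u') v @[u' --> u] --> x0 (\val u) v.
    exact: (cvg_comp (fun u' : piece_nbhd i => \val u') (fun u' =>
      x0 u' v) val_u
      (@cvg_unit_decode true (\val u) v u0)).
  have fy v : y0 (\val u') v @[u' --> u] --> y0 (\val u) v.
    exact: (cvg_comp (fun u' : piece_nbhd i => \val u') (fun u' =>
      y0 u' v) val_u
      (@cvg_unit_decode false (\val u) v u0)).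
  have le1 b (u' : piece_nbhd i) v : `|(unit_decode b (\val u') v).1| <= 1.
    exact: normalize_le1.
  apply: (@cvg_piece _ (nbhs u) _ _ _ FF) => v.
    rewrite (gP u S Si Snear v).1; apply: cvg_trans.
      apply: near_eq_cvg; apply: filterS (gN v) => u' [e _]; by rewrite e.
    exact: (cvg_x2 xc yc fx fy (le1 true) (le1 false) Snear).
  rewrite (gP u S Si Snear v).2; apply: cvg_trans.
    apply: near_eq_cvg; apply: filterS (gN v) => u' [_ e]; by rewrite e.
  exact: (cvg_y2 xc yc fx fy (le1 true) (le1 false) Snear).
- move=> p h; apply: val_inj.
  have [Snear Sval] := embedP p.
  have := gP (exist _ (embed (\val p)) h) _ (set_mem (valP p)) Snear.
  move=> gv; rewrite [LHS]surjective_pairing [RHS]surjective_pairing.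
  by congr (_, _); apply: X_ext => v;
    [rewrite (gv v).1 (Sval v).1|rewrite (gv v).2 (Sval v).2].
- move=> p; split.
    by move=> b v; rewrite decode_embed xval_circle.
  have [Snear _] := embedP p.
  by exists (antipodal_set (\val p)) => //; exact: (set_mem (valP p)).
Qed.

End Pieces.

(** * The motion planner and the theorem *)

Section Slide.
Variable R : realType.
Local Notation C := (R * R)%type.
Implicit Types (x y : C) (t : R).

(** The part of the way from [x] to [y] that is covered during the first half of
    the time. It is 0 if [x] is the base point and 1 if only [y] is, and it is
    continuous except when both are, where the way to cover has length 0. *)
Definition share x y : R := dev x / (dev x + dev y).
Definition progress x y t : R :=
  Num.min (2 * t) 1 * share x y + Num.max (2 * t - 1) 0 * (1 - share x y).

(** The segment from [x] to [y] at [k], bent off the origin in the direction of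
    [x] rotated by a right angle if the flag [a] marks antipodal points. *)
Definition bent (a : bool) x y k : C :=
  ((mix x y k).1 - (if a then 4 * k * (1 - k) else 0) * x.2,
   (mix x y k).2 + (if a then 4 * k * (1 - k) else 0) * x.1).

Definition slide (a : bool) x y t : C :=
  normalize (bent a x y (progress x y t)).

Lemma share01 x y : on_circle x -> on_circle y -> 0 <= share x y <= 1.
Proof.
move=> hx hy; have x0 := dev_ge0 hx; have y0 := dev_ge0 hy.
have [e|e] := eqVneq (dev x + dev y) 0.
  by rewrite /share e invr0 mulr0 lexx ler01.
have s0 : 0 < dev x + dev y by rewrite lt_def e addr_ge0.
apply/andP; split; first by rewrite divr_ge0 // ltW.
by rewrite /share ler_pdivrMr // mul1r lerDl.
Qed.

Lemma progress01 x y t : on_circle x -> on_circle y -> 0 <= t <= 1 ->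
  0 <= progress x y t <= 1.
Proof.
move=> hx hy /andP[t0 t1]; have /andP[s0 s1] := share01 hx hy.
have m0 : 0 <= Num.min (2 * t) 1 <= 1
  by rewrite le_min ge_min lexx ler01 mulr_ge0 ?orbT.
have n0 : 0 <= Num.max (2 * t - 1) 0 <= 1
  by rewrite le_max lexx orbT ge_max ler01 andbT; lra.
rewrite /progress; nra.
Qed.

Lemma progress_early x y t : t <= 1 / 2 -> progress x y t = 2 * t * share x y.
Proof.
by move=> t2; rewrite /progress min_l ?max_r ?mul0r ?addr0 //; lra.
Qed.

Lemma progress_late x y t : 1 / 2 <= t ->
  progress x y t = share x y + (2 * t - 1) * (1 - share x y).
Proof.
by move=> t2; rewrite /progress min_r ?max_l ?mul1r //; lra.
Qed.

Lemma bent_antipodal x k : on_circle x -> dot (bent true x (- x.1, - x.2) k)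
  (bent true x (- x.1, - x.2) k) = (1 - 2 * k) ^+ 2 + (4 * k * (1 - k)) ^+ 2.
Proof.
move=> hx; rewrite -[RHS]mulr1 -[X in _ * X]hx /bent /mix /dot /=; ring.
Qed.

Lemma bent_false x y k : bent false x y k = mix x y k.
Proof. by rewrite /bent !mul0r subr0 addr0; case: (mix _ _ _). Qed.

Lemma bent_neq0 x y k : on_circle x -> on_circle y -> 0 <= k <= 1 ->
  0 < dot (bent (dot x y == -1) x y k) (bent (dot x y == -1) x y k).
Proof.
move=> hx hy k01; have [e|e] := eqVneq (dot x y) (-1).
  rewrite (dotN1 hx hy e) bent_antipodal //.
  have [->|k2] := eqVneq k (1 / 2); first by lra.
  rewrite ltr_pwDl ?sqr_ge0 // exprn_even_gt0 //=.
  by apply: contra k2 => /eqP ?; apply/eqP; lra.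
by rewrite bent_false mix_neq0 // lt_def e dot_geN1.
Qed.

Lemma slide_circle x y t : on_circle x -> on_circle y -> 0 <= t <= 1 ->
  on_circle (slide (dot x y == -1) x y t).
Proof.
by move=> hx hy t01; apply: normalize_circle; apply: bent_neq0 => //;
  exact: progress01.
Qed.

Lemma bent0 a x y : bent a x y 0 = x.
Proof.
by rewrite /bent mix0 mulr0 mul0r; case: a; rewrite !mul0r subr0 addr0; case: x.
Qed.

Lemma bent1 a x y : bent a x y 1 = y.
Proof.
by rewrite /bent mix1 subrr mulr0; case: a; rewrite !mul0r subr0 addr0; case: y.
Qed.

Lemma slide0 x y : on_circle x -> slide (dot x y == -1) x y 0 = x.
Proof.
move=> hx; rewrite /slide progress_early; last by lra.
by rewrite mulr0 mul0r bent0 normalize_id.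
Qed.

Lemma slide1 x y : on_circle y -> slide (dot x y == -1) x y 1 = y.
Proof.
move=> hy; rewrite /slide progress_late; last by lra.
rewrite [X in bent _ _ _ X](_ : _ = 1); last by ring.
by rewrite bent1 normalize_id.
Qed.

Lemma dev_base : dev (base R) = 0. Proof. by rewrite /dev subrr. Qed.

Lemma slide_early y t : t <= 1 / 2 ->
  slide (dot (base R) y == -1) (base R) y t = base R.
Proof.
move=> t2; rewrite /slide progress_early // /share dev_base mul0r mulr0 bent0.
by rewrite normalize_id //; exact: base_circle.
Qed.

Lemma slide_late x t : on_circle x -> 1 / 2 <= t ->
  slide (dot x (base R) == -1) x (base R) t = base R.
Proof.
move=> hx t2; have b := base_circle R.
have [e|e] := eqVneq (dev x) 0.
  rewrite (dev_eq0 hx e) /slide (_ : (dot _ _ == _) = false).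
    by rewrite bent_false mixzz normalize_id.
  by rewrite b; apply/negbTE/eqP; lra.
rewrite /slide progress_late // /share dev_base addr0 divff //.
by rewrite subrr mulr0 addr0 bent1 normalize_id.
Qed.

Lemma cvg_slide (T : Type) (Fi : set_system T)
    (f g : T -> C) (h : T -> R) x y t :
  Filter Fi -> f @ Fi --> x -> g @ Fi --> y -> h @ Fi --> t ->
  (forall s, on_circle (f s)) -> (forall s, on_circle (g s)) ->
  (forall s, 0 <= h s <= 1) -> on_circle x -> on_circle y -> 0 <= t <= 1 ->
  slide (dot x y == -1) (f s) (g s) (h s) @[s --> Fi] -->
    slide (dot x y == -1) x y t.
Proof.
move=> FF fx gy ht fc gc h01 hx hy t01.
apply: cvg_normalize; last by apply: bent_neq0 => //; exact: progress01.
have x0 := dev_ge0 hx; have y0 := dev_ge0 hy.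
have [e|e] := eqVneq (dev x + dev y) 0.
  have xb : x = base R by apply: dev_eq0 => //; lra.
  have yb : y = base R by apply: dev_eq0 => //; lra.
  rewrite xb yb in fx gy *.
  rewrite (_ : (dot _ _ == _) = false); last first.
    by rewrite (base_circle R); apply/negbTE/eqP; lra.
  under eq_cvg do rewrite bent_false.
  rewrite bent_false mixzz; apply: cvg_mix_merge => // s; exact: progress01.
have cdev (f' : T -> C) z : f' @ Fi --> z -> dev (f' s) @[s --> Fi] --> dev z.
  by move=> fz; apply: cvgB; [exact: cvg_cst|exact: cvg_pair1 fz].
have cs : share (f s) (g s) @[s --> Fi] --> share x y.
  apply: cvgM; first exact: cdev.
  by apply: cvgV => //; apply: cvgD; exact: cdev.
have c2h : 2 * h s @[s --> Fi] --> 2 * t by apply: cvgM => //; exact: cvg_cst.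
have ck : progress (f s) (g s) (h s) @[s --> Fi] --> progress x y t.
  apply: cvgD; apply: cvgM.
  - by apply: cvg_min => //; exact: cvg_cst.
  - exact: cs.
  - by apply: cvg_max; [apply: cvgB => //; exact: cvg_cst|exact: cvg_cst].
  - by apply: cvgB => //; exact: cvg_cst.
have cb : (if dot x y == -1 then
      4 * progress (f s) (g s) (h s) * (1 - progress (f s) (g s) (h s)) else 0)
    @[s --> Fi] --> (if dot x y == -1 then
      4 * progress x y t * (1 - progress x y t) else 0).
  case: ifP => _; last exact: cvg_cst.
  apply: cvgM; first by apply: cvgM => //; exact: cvg_cst.
  by apply: cvgB => //; exact: cvg_cst.
have cm : mix (f s) (g s) (progress (f s) (g s) (h s)) @[s --> Fi] -->
    mix x y (progress x y t) by exact: cvg_mix.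
apply: cvg_to_pair => /=.
  by apply: cvgB; [exact: cvg_pair1 cm|apply: cvgM => //; exact: cvg_pair2 fx].
by apply: cvgD; [exact: cvg_pair2 cm|apply: cvgM => //; exact: cvg_pair1 fx].
Qed.

End Slide.

Section UpperBound.
Variables (R : realType) (V : finType) (E : {set {set V}}).
Local Notation X := (X_graph R E).
Local Notation C := (R * R)%type.

(** Outside of both supports, the two coordinates are at the base point. *)
Lemma antipodal_set_le (p : X * X) : (#|antipodal_set p| <= z_graph E)%N.
Proof.
have [K KE xK] := xval_clique p.1; have [L LE yL] := xval_clique p.2.
apply: leq_trans (_ : #|K :|: L|%SET <= _)%N; last first.
  by apply: (@leq_bigmax_cond _ _ (fun K => #|K.1 :|: K.2|%SET) (K, L));
    rewrite /= KE.
apply: subset_leq_card; apply/fintype.subsetP => v;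
  rewrite inE finset.in_setU => /eqP xy.
apply/negPn/negP; rewrite negb_or => /andP[vK vL]; move: xy.
by rewrite xK // yL // (base_circle R); lra.
Qed.

(** Being non-antipodal is an open condition, so the antipodal set can only
    become smaller nearby, and its cardinality is fixed on a stratum. *)
Lemma antipodal_set_near i (p0 : @piece R V E i) : \forall p \near p0,
  antipodal_set (\val p) = antipodal_set (\val p0).
Proof.
have FF : Filter (nbhs p0) by exact: nbhs_filter.
have sub : \forall p \near p0, forall v, v \notin antipodal_set (\val p0) ->
    v \notin antipodal_set (\val p).
  apply: (filter_forall (F := nbhs p0)) => v.
  have [vS|vS] := boolP (v \in antipodal_set (\val p0)); first exact: nearW.
  have dotc : dot (xval (\val p).1 v) (xval (\val p).2 v) @[p --> p0] -->
      dot (xval (\val p0).1 v) (xval (\val p0).2 v).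
    by apply: cvg_dot; [exact: continuous_xval1|exact: continuous_xval2].
  have d0 : -1 < dot (xval (\val p0).1 v) (xval (\val p0).2 v).
    rewrite lt_def dot_geN1 ?andbT; try exact: xval_circle.
    by move: vS; rewrite inE.
  by apply: filterS (cvgr_gt _ dotc _ d0) => p dp _; rewrite inE gt_eqF.
apply: filterS sub => p sub; apply/eqP; rewrite eqEcard.
rewrite (set_mem (valP p) : #|_| = i) (set_mem (valP p0) : #|_| = i).
rewrite leqnn andbT.
by apply/fintype.subsetP => v; apply: contraLR; exact: sub.
Qed.

(** Up to time 1/2 the support of the moving point is contained in that of the
    initial point, afterwards in that of the final point. *)
Lemma piece_section i : exists s : @piece R V E i -> path_space R X,
  continuous s /\ forall p, endpoints (s p) = \val p.
Proof.
pose f (q : @piece R V E i * @unit_interval R) v : C :=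
  slide (v \in antipodal_set (\val q.1))
    (xval (\val q.1).1 v) (xval (\val q.1).2 v) (\val q.2).
have fE q v : f q v =
  slide (dot (xval (\val q.1).1 v) (xval (\val q.1).2 v) == -1)
    (xval (\val q.1).1 v) (xval (\val q.1).2 v) (\val q.2).
  by rewrite /f inE.
have /choice[H HP] : forall q, exists x : X, forall v, xval x v = f q v.
  move=> q; have fc v : on_circle (f q v).
    by rewrite fE; apply: slide_circle;
      [exact: xval_circle..|exact: interval01].
  have [K KE xK] := xval_clique (\val q.1).1.
  have [L LE yL] := xval_clique (\val q.1).2.
  have [t2|/ltW t2] := leP (\val q.2) (1 / 2).
    by apply: (X_build KE fc) => v /xK xv; rewrite fE xv; exact: slide_early.
  apply: (X_build LE fc) => v /yL yv; rewrite fE yv.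
  by apply: slide_late => //; exact: xval_circle.
have Hc : continuous H.
  move=> [p0 t0]; have FF : Filter (nbhs (p0, t0)) by exact: nbhs_filter.
  apply: (@cvg_X _ _ _ _ (nbhs (p0, t0)) _ _ FF) => v; rewrite HP fE.
  have near_flag : \forall q \near (p0, t0), f q v =
      slide (dot (xval (\val p0).1 v) (xval (\val p0).2 v) == -1)
        (xval (\val q.1).1 v) (xval (\val q.1).2 v) (\val q.2).
    have same : \forall q \near (p0, t0),
        antipodal_set (\val q.1) = antipodal_set (\val p0).
      exact: (@cvg_fst _ _ (nbhs p0) (nbhs t0) _ _ (antipodal_set_near p0)).
    by apply: filterS same => -[p t] /= ap; rewrite /f /= ap inE.
  apply: cvg_trans.
    by apply: near_eq_cvg; apply: filterS near_flag => q; rewrite HP => ->.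
  apply: cvg_slide; try (by move=> *; exact: xval_circle);
    try exact: interval01.
  - exact: (cvg_comp (@fst _ _) _ (@cvg_fst _ _ (nbhs p0) (nbhs t0) _)
    (@continuous_xval1 _ _ _ i v p0)).
  - exact: (cvg_comp (@fst _ _) _ (@cvg_fst _ _ (nbhs p0) (nbhs t0) _)
    (@continuous_xval2 _ _ _ i v p0)).
  - exact: (cvg_comp (@snd _ _) _ (@cvg_snd _ _ (nbhs p0) (nbhs t0) _)
    (@continuous_val _ _ t0)).
  - by move=> q; exact: interval01.
have [s sc sP] := continuous_path_curry Hc.
exists s; split=> // p; rewrite /endpoints !sP [RHS]surjective_pairing.
congr (_, _); apply: X_ext => v; rewrite HP fE /=.
  by apply: slide0; exact: xval_circle.
by apply: slide1; exact: xval_circle.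
Qed.

Theorem planner_upper_bound : has_motion_planner R X (z_graph E + 1).
Proof.
exists (fun i => @piece R V E i); split.
- by move=> i j _ _ [p [pi pj]]; apply: val_inj; rewrite /= -pi -pj.
- apply/seteqP; split=> // p _.
  have pz : (#|antipodal_set p| < z_graph E + 1)%N
    by rewrite addn1 ltnS antipodal_set_le.
  by exists (Ordinal pz).
- by move=> i; exact: piece_ENR.
exists (fun i : 'I_(z_graph E + 1) => projT1 (cid (piece_section i))) => i.
exact: (projT2 (cid (piece_section i))).
Qed.

End UpperBound.

Theorem theorem4p1 (R : realType) (V : finType) (E : {set {set V}})
    (hE : is_simple_graph E) :
  is_TC R (X_graph R E) (z_graph E + 1)%N.
Proof.
by split; [exact: planner_upper_bound | exact: planner_lower_bound].
Qed.
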